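(* Let $0<\alpha<1$ and $a,b,c\in\mathbb{R}$. If $c<0$, $b>0$ and $-\infty<a<\frac{-1}{4c}-b$, then the equation $D^{\alpha}x(t)+c\,D^{2\alpha}x(t)=a\,x(t)+b\,x(t-\tau)$ is unstable for all $\tau\ge 0$.
   Context: $D^{\mu}$ denotes the Caputo fractional derivative (base point $0$) in $t$: for $m\in\mathbb{N}$ and $m-1<\mu<m$, $D^{\mu}f(t)=\frac{1}{\Gamma(m-\mu)}\int_0^t (t-s)^{m-\mu-1}f^{(m)}(s)\,ds$, and $D^{m}f=f^{(m)}$. The equation is considered for $t>0$ with delay $\tau\ge 0$ and a prescribed history on $[-\tau,0]$ (together with a prescribed value $x'(0)$ when $1<2\alpha<2$). The characteristic equation is $\lambda^{\alpha}+c\lambda^{2\alpha}=a+b\,e^{-\lambda\tau}$ (principal branch of powers). For a given $\tau\ge 0$ the equation is called stable if all its solutions are bounded as $t\to\infty$, and unstable if it is not stable. The paper uses as its criterion that the existence of a positive real root $\lambda>0$ of the characteristic equation is sufficient for instability.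
   Formalization: Instability is not claimed when τ = 0, a + b = 0 and 2α ≤ 1: there the equation D^αx + cD^{2α}x = 0 has only constant solutions, so it is stable; the existence of a positive real root of the characteristic equation is proved in all cases. *)

(* Defs.v *)
From HB Require Import structures.
From mathcomp Require Export all_boot all_order all_algebra.
From mathcomp Require Export all_classical all_reals all_analysis.
Set Implicit Arguments.
Unset Strict Implicit.
Unset Printing Implicit Defensive.
Export Order.TTheory GRing.Theory Num.Theory numFieldNormedType.Exports.

Local Open Scope classical_set_scope.
Local Open Scope ring_scope.

(* Euler's Gamma function; only used at z > 0, where the integral converges. *)
Definition Gamma (R : realType) (z : R) : R :=
  \int[lebesgue_measure]_(t in `]0, +oo[) (t `^ (z - 1) * expR (- t)).

(* The finite families of non-overlapping subintervals [u i, v i] are listed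
   from left to right. *)
Definition absolutely_continuous_on (R : realType) (I : set R) (f : R -> R) :
    Prop :=
  forall eps : R, 0 < eps -> exists2 delta : R, 0 < delta &
    forall (n : nat) (u v : nat -> R),
      (forall i, (i < n)%N -> [/\ I (u i), I (v i) & u i <= v i]) ->
      (forall i j, (i < j < n)%N -> v i <= u j) ->
      \sum_(i < n) (v i - u i) < delta ->
      \sum_(i < n) `|f (v i) - f (u i)| < eps.

(* For mu > 0, the natural number m with m - 1 < mu <= m. *)
Definition caputo_order (R : realType) (mu : R) : nat := `|Num.ceil mu|%N.

(* Caputo derivative of order mu > 0 with base point 0, at t > 0. *)
Definition caputo (R : realType) (mu : R) (f : R -> R) (t : R) : R :=
  let m := caputo_order mu in
  if mu == m%:R then derive1n m f t
  else (Gamma (m%:R - mu))^-1 *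
       \int[lebesgue_measure]_(s in `[0, t])
          ((t - s) `^ (m%:R - mu - 1) * derive1n m f s).

(* derive1n and the integral are total operators, so caputo mu f t is meaningful
   only under the following condition: the (m-1)-st derivative of f exists on
   ]0, +oo[ and is locally absolutely continuous up to 0, so that the m-th one
   exists almost everywhere and is locally integrable up to 0; moreover the
   latter exists at t if mu = m, and the integral converges absolutely if
   mu < m.  When mu < m the m-th derivative is not required to exist
   everywhere: with a delay it can fail to exist at multiples of the delay. *)
Definition caputo_derivable (R : realType) (mu : R) (f : R -> R) : Prop :=
  let m := caputo_order mu in
  [/\ forall (k : nat) (t : R), (k < m.-1)%N -> 0 < t ->
        derivable (derive1n k f) t 1,
      forall T : R, 0 < T -> absolutely_continuous_on `]0, T] (derive1n m.-1 f) &
      forall t : R, 0 < t ->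
        if mu == m%:R then derivable (derive1n m.-1 f) t 1
        else lebesgue_measure.-integrable `[0, t]
               (fun s => ((t - s) `^ (m%:R - mu - 1) * derive1n m f s)%:E)].

(* x solves D^alpha x(t) + c D^(2 alpha) x(t) = a x(t) + b x(t - tau) for all
   t > 0, with history phi on [-tau, 0] and, when 2 alpha > 1, x'(0+) = x1.
   The values of x to the left of -tau play no role. *)
Definition is_solution (R : realType) (alpha a b c tau : R)
    (phi : R -> R) (x1 : R) (x : R -> R) : Prop :=
  [/\ {within `[- tau, +oo[, continuous x},
      forall t : R, - tau <= t <= 0 -> x t = phi t,
      1 < 2 * alpha -> h^-1 * (x h - x 0) @[h --> 0^'+] --> x1,
      caputo_derivable alpha x /\ caputo_derivable (2 * alpha) x &
      forall t : R, 0 < t ->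
        caputo alpha x t + c * caputo (2 * alpha) x t =
        a * x t + b * x (t - tau)].

Definition stable (R : realType) (alpha a b c tau : R) : Prop :=
  forall (phi : R -> R) (x1 : R) (x : R -> R),
    is_solution alpha a b c tau phi x1 x -> bounded_near x +oo.

Definition unstable (R : realType) (alpha a b c tau : R) : Prop :=
  ~ stable alpha a b c tau.

(* Restricted to real lambda > 0, where powR is the principal branch. *)
Definition characteristic_root (R : realType) (alpha a b c tau lambda : R) :
    Prop :=
  lambda `^ alpha + c * lambda `^ (2 * alpha) = a + b * expR (- (lambda * tau)).

(* For tau = 0, a + b = 0 and 2 alpha <= 1 the equation reads
   D^alpha x + c D^(2 alpha) x = 0 and x(0) is the only datum.  With
   y = D^(2 alpha) x one has D^alpha x = I^alpha y, so c y + I^alpha y = 0;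
   this Volterra equation forces y = 0 almost everywhere, and x is constant.
   All solutions are then bounded although, for c < 0, the characteristic
   equation has the positive root lambda = (-1/c) `^ (1/alpha): the residue of
   the Laplace transform at that root vanishes.  Outside this case suitable
   initial data make the residue at a positive root nonzero. *)
Definition nondegenerate (R : realType) (alpha a b tau : R) : Prop :=
  [\/ 0 < tau, a + b <> 0 | 1 < 2 * alpha].

(* Main.v *)
(** The root: at lambda^alpha = -1/(2c) the left-hand side u + c u^2 of the
    characteristic equation takes its maximal value -1/(4c) > a + b, and it
    tends to -oo afterwards, so the intermediate value theorem applies.

    Instability: let k_nu(t) = t^(nu-1) / Gamma(nu) for t > 0 and 0 for t <= 0,
    and let J^m be the convolution with k_m, so that J^m k_n = k_(m+n).  Put
      V y = c y + J^alpha y - a J^(2 alpha) y - b (J^(2 alpha) y)(. - tau).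
    In the norm sup |y(t)| e^(-s t) with s large, V is c times a perturbation of
    the identity by a contraction, so V y = f is solvable.  Solutions of the
    Caputo equation are built as follows:
    - tau > 0: x = J^2 y for t > 0, with zero initial values and a history that
      is a quadratic B-spline supported in [-tau, 0]; f is the third difference
      of k_(1 + 2 alpha);
    - tau = 0, 2 alpha <= 1: x = 1 + J y with f = (a + b) k_(2 alpha);
    - tau = 0, 2 alpha > 1: x = k_2 + J^2 y with
      f = - k_alpha + (a + b) k_(2 alpha).
    In each case V v = J^n f for v = J^n y.  If x were bounded, v could be
    Laplace transformed at the positive root lambda, and the transform of V v
    would vanish there, because it is lambda^(-2 alpha) times the
    characteristic function times the transform of v.  But the transform of
    J^n f at lambda is nonzero. *)

From HB Require Import structures.
Require Import Defs.
From mathcomp Require Import measurable_realfun ring lra.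
Set Implicit Arguments.
Unset Strict Implicit.
Unset Printing Implicit Defensive.
Local Open Scope classical_set_scope.
Local Open Scope ring_scope.

(** * Affine changes of variable *)

Section Affine.
Variable R : realType.
Local Notation mu := (@lebesgue_measure R).

Lemma measurable_reflect (t : R) : measurable_fun [set: R] (fun x : R => t - x).
Proof. exact: measurable_funB. Qed.

Lemma measurable_mulr (a : R) : measurable_fun [set: R] (fun x : R => x * a).
Proof. exact: measurable_funM. Qed.

(** Lebesgue measure is determined by its values on half-open intervals, and reflection keeps their
    length while swapping which end is closed. *)
Lemma lebesgue_measure_reflect (t : R) (A : set R) : measurable A ->
  pushforward mu ((fun x : R => t - x) : _ -> measurableTypeR R) A = mu A.
Proof.
move=> mA; apply/esym/lebesgue_measure_unique => //=.
  exact: measurable_reflect.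
move=> mphi _ [[p q] _ <-].
rewrite /pushforward (_ : _ @^-1` _ = `[t - q, t - p[%classic).
  by rewrite !lebesgue_measure_itv/= !lte_fin ltrD2l ltrN2; case: ifP => // _;
    rewrite -!EFinB; congr (_%:E); ring.
by apply/seteqP; split => x /=; rewrite !in_itv/= => /andP[? ?]; apply/andP; split; lra.
Qed.

Lemma ge0_integral_reflect (t : R) (f : R -> \bar R) :
  measurable_fun [set: R] f -> (forall x, 0 <= f x)%E ->
  (\int[mu]_x f (t - x)%R = \int[mu]_x f x)%E.
Proof.
move=> mf f0.
transitivity (\int[pushforward mu ((fun x : R => t - x)%R : _ -> measurableTypeR R)]_x f x)%E.
  by rewrite ge0_integral_pushforward//; exact: measurable_reflect.
apply: eq_measure_integral => [|mphi A mA _]; first exact: measurable_reflect.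
exact/lebesgue_measure_reflect.
Qed.

Lemma ge0_integral_shift (t : R) (f : R -> \bar R) :
  measurable_fun [set: R] f -> (forall x, 0 <= f x)%E ->
  (\int[mu]_x f (x - t)%R = \int[mu]_x f x)%E.
Proof.
move=> mf f0; rewrite -(ge0_integral_reflect 0 mf f0).
rewrite -(@ge0_integral_reflect t (fun x => f (0 - x)%R))//.
  by apply: eq_integral => x _; congr f; ring.
by apply: measurableT_comp mf _; exact: measurable_reflect.
Qed.

Lemma lebesgue_measure_scale (a : R) (A : set R) : 0 < a -> measurable A ->
  (a%:E * pushforward mu ((fun x : R => (x * a)%R) : _ -> measurableTypeR R) A =
   mu A)%E.
Proof.
move=> a0 mA.
pose phi : measurableTypeR R -> measurableTypeR R := fun x : R => x * a.
have mphi : measurable_fun setT phi by exact: measurable_mulr.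
pose nu0 : {measure set (measurableTypeR R) -> \bar R} := pushforward mu phi.
pose nu : {measure set (measurableTypeR R) -> \bar R} :=
  mscale (NngNum (ltW a0)) (nu0 mphi).
apply/esym; change (mu A = nu A); move: A mA.
apply: lebesgue_measure_unique => _ [[p q] _ <-].
rewrite /nu /nu0 /= /mscale/= /pushforward (_ : _ @^-1` _ = `]p / a, q / a]%classic).
  rewrite !lebesgue_measure_itv/= !lte_fin ltr_pM2r ?invr_gt0//.
  case: ifP => // _; last by rewrite mule0.
  by rewrite -!EFinB -EFinM; congr (_%:E); field; rewrite gt_eqF.
by apply/seteqP; split => x /=; rewrite !in_itv/= ltr_pdivrMr// ler_pdivlMr.
Qed.

Lemma ge0_integral_scale (a : R) (f : R -> \bar R) : 0 < a ->
  measurable_fun [set: R] f -> (forall x, 0 <= f x)%E ->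
  (\int[mu]_x f x = a%:E * \int[mu]_x f (x * a)%R)%E.
Proof.
move=> a0 mf f0.
pose phi : measurableTypeR R -> measurableTypeR R := fun x : R => x * a.
have mphi : measurable_fun setT phi by exact: measurable_mulr.
pose k := NngNum (ltW a0).
pose nu : {measure set (measurableTypeR R) -> \bar R} := pushforward mu phi.
transitivity (k%:num%:E * \int[nu mphi]_x f x)%E.
  rewrite -(ge0_integral_mscale (nu mphi))//.
  apply: eq_measure_integral => //= A mA _.
  exact/esym/lebesgue_measure_scale.
by rewrite ge0_integral_pushforward.
Qed.
End Affine.

(** * The Gamma function *)

Section GammaFunction.
Variable R : realType.
Local Notation mu := (@lebesgue_measure R).

(** Linearise the logarithm: ln v <= v - 1 at v = s u / (p + 1). The denominator p + 1 instead of p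
    keeps p = 0 inside the same computation. *)
Lemma powR_le_expR (p s : R) : 0 <= p -> 0 < s ->
  exists2 C : R, 0 < C & forall u : R, 0 < u -> u `^ p <= C * expR (s * u).
Proof.
move=> p0 s0; pose K := ln ((p + 1) / s) - 1.
have q0 : 0 < p + 1 by lra.
exists (expR (p * K)); first exact: expR_gt0.
move=> u u0; rewrite -expRD /powR gt_eqF// ler_expR.
have lnu : ln u <= s * u / (p + 1) + K.
  have x0 : 0 < s * u / (p + 1) by rewrite divr_gt0// mulr_gt0.
  have -> : ln u = ln (1 + (s * u / (p + 1) - 1)) + ln ((p + 1) / s).
    have {1}-> : u = s * u / (p + 1) * ((p + 1) / s) by field; rewrite !gt_eqF.
    by rewrite lnM ?posrE ?divr_gt0 ?mulr_gt0// subrKC.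
  by rewrite /K; have := @le_ln1Dx R (s * u / (p + 1) - 1); lra.
apply: le_trans (ler_wpM2l p0 lnu) _; rewrite mulrDr [leLHS]addrC lerD2l.
rewrite mulrCA; apply: ler_piMr; first by rewrite mulr_ge0 ?ltW.
by rewrite ler_pdivrMr// mul1r; lra.
Qed.

Lemma is_derive_invr1D_powR (p x : R) : 0 < x ->
  is_derive x 1 (fun u => - (1 + u `^ p)^-1)
    (p * x `^ (p - 1) / (1 + x `^ p) ^+ 2).
Proof.
move=> x0.
have d1 := is_derive1_powR p x0.
have h0 : 1 + x `^ p != 0 by rewrite gt_eqF// ltr_wpDr// powR_ge0.
have d2 : is_derive x 1 (fun u : R => 1 + u `^ p) (0 + p * x `^ (p - 1)).
  exact: is_deriveD.
have d3 : is_derive x 1 (fun u : R => (1 + u `^ p)^-1)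
    (- (1 + x `^ p) ^- 2 *: (0 + p * x `^ (p - 1))) by exact: is_deriveV.
have d4 := is_deriveN d3.
apply: is_derive_eq => //=.
by rewrite /GRing.scale /= add0r mulNr opprK mulrC.
Qed.

(** Cut off at 0, so that convolutions over the whole line only see the interval ]0, t[. *)
Definition pow_pos (nu u : R) : R := if 0 < u then u `^ (nu - 1) else 0.

Lemma pow_pos_ge0 nu u : 0 <= pow_pos nu u.
Proof. by rewrite /pow_pos; case: ifP => // _; exact: powR_ge0. Qed.

Lemma measurable_pow_pos nu : measurable_fun [set: R] (pow_pos nu).
Proof.
apply: measurable_fun_if => //=.
- exact: measurable_fun_ltr.
- by apply: measurable_funTS; exact: measurable_powR.
Qed.

Lemma continuous_powR_pos (p x : R) : 0 < x -> {for x, continuous (@powR R ^~ p)}.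
Proof.
move=> x0; have [dx _] := is_derive1_powR p x0.
exact/differentiable_continuous/derivable1_diffP.
Qed.

(** The Gamma integrand is dominated by a multiple of the derivative of the bounded function -1/(1 +
    u^nu). This handles the singularity at 0 and the tail at once, with a bound independent of the
    interval. *)
Lemma integral_pow_pos_expR_itv (nu : R) : 0 < nu ->
  exists C : R, forall a b : R, 0 < a -> a < b ->
  (\int[mu]_(u in `[a, b]) (pow_pos nu u * expR (- u))%:E <= C%:E)%E.
Proof.
move=> nu0; have [C C0 hC] := @powR_le_expR (2 * nu) 1 ltac:(lra) ltac:(lra).
(* With v = u^nu, (1 + v)^2 <= 2 + 2 v^2 <= (2 + 2 C) e^u, because 1 <= e^u and u^(2 nu) <= C
   e^u. *)
exists ((2 + 2 * C) / nu) => a b a0 ab.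
pose f (u : R) := nu * u `^ (nu - 1) / (1 + u `^ nu) ^+ 2.
pose F (u : R) := - (1 + u `^ nu)^-1.
have h0 (u : R) : 0 < 1 + u `^ nu by rewrite ltr_wpDr// powR_ge0.
have f0 (u : R) : 0 <= f u.
  by rewrite /f mulr_ge0 ?invr_ge0 ?sqr_ge0// mulr_ge0 ?powR_ge0// ltW.
have dF (u : R) : 0 < u -> is_derive (u : R) 1 F (f u).
  by move=> u0; exact: is_derive_invr1D_powR.
have cf : {within `[a, b], continuous f}.
  apply: continuous_in_subspaceT => x; rewrite inE/= in_itv/= => /andP[ax _].
  have x0 := lt_le_trans a0 ax.
  apply: cvgM; first by apply: cvgM; [exact: cvg_cst|exact: continuous_powR_pos].
  apply: cvgV; first by rewrite expf_neq0// gt_eqF.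
  rewrite /= !expr2; apply: cvgM; apply: cvgD; by [exact: cvg_cst|exact: continuous_powR_pos].
have Fab : (\int[mu]_(u in `[a, b]) (f u)%:E = (F b)%:E - (F a)%:E)%E.
  apply: continuous_FTC2 => //.
  - have cF x : a <= x -> {for x, continuous F}.
      move=> ax; have [dx _] := dF x (lt_le_trans a0 ax).
      exact/differentiable_continuous/derivable1_diffP.
    split.
    + by move=> x; rewrite in_itv/= => /andP[ax _]; have [] := dF x (lt_trans a0 ax).
    + by apply: cvg_at_right_filter; exact: cF.
    + by apply: cvg_at_left_filter; apply: cF; exact: ltW.
  - move=> x; rewrite in_itv/= => /andP[ax _].
    by rewrite derive1E; have [] := dF x (lt_trans a0 ax).
have mf : measurable_fun `[a, b] f.
  by apply: subspace_continuous_measurable_fun.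
have D0 : 0 <= (2 + 2 * C) / nu by rewrite divr_ge0 ?ltW//; lra.
apply: (@le_trans _ _ (\int[mu]_(u in `[a, b]) ((2 + 2 * C) / nu * f u)%:E)%E).
  apply: ge0_le_integral => //=.
  - by move=> u _; rewrite lee_fin mulr_ge0// ?pow_pos_ge0// expR_ge0.
  - apply/measurable_EFinP/measurable_funTS/measurable_funM.
      exact: measurable_pow_pos.
    by apply: measurableT_comp => //; exact: measurable_expR.
  - by apply/measurable_EFinP; exact: measurable_funM.
  - move=> u; rewrite in_itv/= => /andP[au _]; rewrite lee_fin.
    have u0 := lt_le_trans a0 au.
    rewrite /pow_pos u0 /f.
    have -> : (2 + 2 * C) / nu * (nu * u `^ (nu - 1) / (1 + u `^ nu) ^+ 2) =
      u `^ (nu - 1) * ((2 + 2 * C) / (1 + u `^ nu) ^+ 2).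
      by field; rewrite !gt_eqF.
    rewrite ler_wpM2l ?powR_ge0// expRN ler_pdivlMr ?exprn_gt0//.
    rewrite mulrC ler_pdivrMr ?expR_gt0//.
    have := hC u u0; rewrite mul1r (mulrC 2) powRrM powR_mulrn ?powR_ge0//.
    have : 1 <= expR u by apply: le_trans (expR_ge1Dx u); lra.
    have := sqr_ge0 (1 - u `^ nu).
    by rewrite !expr2; nra.
under eq_integral do rewrite EFinM.
rewrite ge0_integralZl//=; last 2 first.
- exact/measurable_EFinP.
- by move=> u _; rewrite lee_fin.
rewrite Fab -EFinB -EFinM lee_fin ler_piMr// /F opprK addrC.
have : (1 + a `^ nu)^-1 <= 1 by rewrite invf_le1// lerDl powR_ge0.
have : 0 < (1 + b `^ nu)^-1 by rewrite invr_gt0.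
lra.
Qed.

Lemma integral_pow_pos_expR_lty (nu : R) : 0 < nu ->
  (\int[mu]_u (pow_pos nu u * expR (- u))%:E < +oo)%E.
Proof.
move=> nu0; have [C hC] := integral_pow_pos_expR_itv nu0.
(* With n + 2 the interval is nondegenerate already at n = 0. These intervals exhaust the positive
   half-line, so monotone convergence carries the uniform bound over. *)
pose A n := `[n.+2%:R^-1, n.+2%:R]%classic : set R.
have mh : measurable_fun [set: R] (fun u => (pow_pos nu u * expR (- u))%:E).
  apply/measurable_EFinP/measurable_funM; first exact: measurable_pow_pos.
  by apply: measurableT_comp => //; exact: measurable_expR.
have h0 (u : R) : (0 <= (pow_pos nu u * expR (- u))%:E)%E.
  by rewrite lee_fin mulr_ge0// ?pow_pos_ge0// expR_ge0.
have -> : (\int[mu]_u (pow_pos nu u * expR (- u))%:E =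
    \int[mu]_(u in \bigcup_n A n) (pow_pos nu u * expR (- u))%:E)%E.
  rewrite [RHS]integral_mkcond; apply: eq_integral => u _.
  rewrite patchE; case: ifPn => // /negP; rewrite inE => nAu.
  rewrite /pow_pos; case: ifPn => [u0|_]; last by rewrite mul0r.
  exfalso; apply: nAu; pose n := (Num.truncn u + Num.truncn u^-1)%N.
  exists n; first by [].
  rewrite /A/= in_itv/=.
  have u1 : u <= n.+2%:R.
    by apply: le_trans (ltW (truncnS_gt u)) _; rewrite ler_nat ltnS leqW// leq_addr.
  have u2 : u^-1 <= n.+2%:R.
    by apply: le_trans (ltW (truncnS_gt u^-1)) _; rewrite ler_nat ltnS leqW// leq_addl.
  by rewrite u1 andbT invf_ple ?posrE.
have ndA : nondecreasing_seq A.
  apply/nondecreasing_seqP => n; rewrite subsetEset => x; rewrite /A/= !in_itv/=.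
  move=> /andP[h1 h2]; apply/andP; split.
    by apply: le_trans h1; rewrite lef_pV2 ?posrE// ler_nat.
  by apply: le_trans h2 _; rewrite ler_nat.
have mhA i : measurable_fun (A i) (fun u => (pow_pos nu u * expR (- u))%:E).
  exact: measurable_funTS.
have cvgA : (\int[mu]_(u in A n) (pow_pos nu u * expR (- u))%:E)%E @[n --> \oo] -->
    (\int[mu]_(u in \bigcup_n A n) (pow_pos nu u * expR (- u))%:E)%E.
  apply: ge0_nondecreasing_set_cvg_integral => //.
  by move=> i; exact: measurable_itv.
apply: (@le_lt_trans _ _ C%:E); last exact: ltry.
rewrite -(cvg_lim _ cvgA)//; apply: lime_le; first by apply/cvg_ex; eexists; exact: cvgA.
near=> n; apply: hC; first by rewrite invr_gt0.
by rewrite (@le_lt_trans _ _ 1)// ?invf_le1// ?ler1n// ltr1n.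
Unshelve. all: by end_near. Qed.

Lemma integral_pow_pos_expR (nu : R) : 0 < nu ->
  (\int[mu]_u (pow_pos nu u * expR (- u))%:E = (Gamma nu)%:E)%E.
Proof.
move=> nu0; rewrite /Gamma /Rintegral.
have E : (\int[mu]_(t in `]0%R, +oo[) (t `^ (nu - 1) * expR (- t))%:E =
    \int[mu]_u (pow_pos nu u * expR (- u))%:E)%E.
  rewrite [LHS]integral_mkcond/=; apply: eq_integral => u _.
  rewrite patchE /pow_pos mem_setE in_itv/= andbT.
  by case: ifP => // _; rewrite mul0r.
rewrite E fineK// ge0_fin_numE; first exact: integral_pow_pos_expR_lty.
by apply: integral_ge0 => u _; rewrite lee_fin mulr_ge0 ?pow_pos_ge0 ?expR_ge0.
Qed.

Lemma Gamma_gt0 (nu : R) : 0 < nu -> 0 < Gamma nu.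
Proof.
move=> nu0; rewrite -lte_fin -integral_pow_pos_expR//.
(* A lower bound of the integrand on [1, 2]: there u^(nu - 1) >= u^(-1) >= 1/2 and e^(-u) >=
   e^(-2). *)
pose c : R := 2^-1 * expR (- 2).
have c0 : 0 < c by rewrite mulr_gt0// ?expR_gt0// invr_gt0.
have mh : measurable_fun [set: R] (fun u => (pow_pos nu u * expR (- u))%:E).
  apply/measurable_EFinP/measurable_funM; first exact: measurable_pow_pos.
  by apply: measurableT_comp => //; exact: measurable_expR.
apply: (@lt_le_trans _ _ (\int[mu]_(u in `[1%R, 2%R]) (pow_pos nu u * expR (- u))%:E)%E).
  apply: (@lt_le_trans _ _ (\int[mu]_(u in `[1%R, 2%R]) (cst c%:E u))%E).
    rewrite integral_cst//= lebesgue_measure_itv/= lte_fin ltr1n -EFinB -EFinM lte_fin.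
    by rewrite mulr_gt0//; lra.
  apply: ge0_le_integral => //=.
  - by move=> u _; rewrite lee_fin ltW.
  - exact: measurable_funTS.
  - move=> u; rewrite in_itv/= => /andP[u1 u2]; rewrite lee_fin.
    have u0 : 0 < u by lra.
    rewrite /pow_pos u0 ler_pM ?invr_ge0 ?expR_ge0//; last by rewrite ler_expR lerN2.
    apply: (@le_trans _ _ (u `^ (- 1))).
      rewrite (_ : u `^ (- 1) = u^-1); last by apply: powR_inv1; lra.
      by rewrite lef_pV2 ?posrE.
    by apply: ler_powR => //; lra.
apply: ge0_subset_integral => //.
by move=> u _; rewrite lee_fin mulr_ge0 ?pow_pos_ge0 ?expR_ge0.
Qed.

End GammaFunction.

(** * Integrals over the real line *)

Section RealIntegrals.
Variable R : realType.
Local Notation mu := (@lebesgue_measure R).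

Definition int_on_R (f : R -> R) : Prop := mu.-integrable [set: R] (EFin \o f).

Lemma int_on_R_measurable (f : R -> R) : int_on_R f -> measurable_fun [set: R] f.
Proof. by move=> /integrableP[/measurable_EFinP]. Qed.

Lemma eq_int_on_R (f g : R -> R) : f =1 g -> int_on_R f -> int_on_R g.
Proof. by move=> /funext ->. Qed.

Lemma EFin_Rintegral (f : R -> R) : int_on_R f ->
  ((\int[mu]_x f x)%:E = \int[mu]_x (f x)%:E)%E.
Proof. by move=> fi; rewrite /Rintegral fineK//; exact: integrable_fin_num. Qed.

Lemma int_on_R_le (f g : R -> R) : measurable_fun [set: R] f -> int_on_R g ->
  (forall x, `|f x| <= g x) -> int_on_R f.
Proof.
move=> mf gi fg; apply: (le_integrable _ _ _ gi) => //=.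
  exact/measurable_EFinP.
by move=> x _; rewrite lee_fin (le_trans (fg x))// ler_norm.
Qed.

Lemma int_on_R_ge0P (f : R -> R) : measurable_fun [set: R] f ->
  (forall x, 0 <= f x) -> (\int[mu]_x (f x)%:E < +oo)%E -> int_on_R f.
Proof.
move=> mf f0 fi; apply/integrableP; split; first exact/measurable_EFinP.
by under eq_integral do rewrite /= ger0_norm//.
Qed.

Lemma int_on_R_norm (f : R -> R) : int_on_R f -> int_on_R (fun x => `|f x|).
Proof. by move=> fi; exact: (integrable_norm fi). Qed.

Lemma int_on_R_lty (f : R -> R) : int_on_R f -> (\int[mu]_x `|f x|%:E < +oo)%E.
Proof. by move=> /integrableP[]. Qed.

Lemma int_on_RD (f g : R -> R) : int_on_R f -> int_on_R g ->
  int_on_R (fun x => f x + g x).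
Proof. by move=> fi gi; exact: (integrableD _ fi gi). Qed.

Lemma int_on_RZ (k : R) (f : R -> R) : int_on_R f -> int_on_R (fun x => k * f x).
Proof. by move=> fi; exact: (integrableZl _ k fi). Qed.

Lemma int_on_RS (f : R -> R) (D : set R) : measurable D -> int_on_R f ->
  mu.-integrable D (EFin \o f).
Proof.
by move=> mD; apply: integrableS; [exact: measurableT|exact: mD|exact: subsetT].
Qed.

Lemma int_on_R_reflect (t : R) (f : R -> R) : int_on_R f ->
  int_on_R (fun x => f (t - x)).
Proof.
move=> /[dup] fi /integrableP[mf fy]; apply/integrableP; split.
  by apply: measurableT_comp mf _; exact: measurable_reflect.
rewrite (ge0_integral_reflect t (f := fun x => `|(f x)%:E|%E))//.
exact: measurableT_comp.
Qed.

Lemma Rintegral_reflect (t : R) (f : R -> R) : int_on_R f ->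
  \int[mu]_x f (t - x) = \int[mu]_x f x.
Proof.
move=> /integrableP[/= mf _]; rewrite /Rintegral; congr fine.
rewrite [LHS]integralE [RHS]integralE; congr (_ - _)%E.
- rewrite -[RHS](ge0_integral_reflect t (measurable_funepos mf) (funepos_ge0 _)).
  by apply: eq_integral => x _; rewrite !funeposE.
- rewrite -[RHS](ge0_integral_reflect t (measurable_funeneg mf) (funeneg_ge0 _)).
  by apply: eq_integral => x _; rewrite !funenegE.
Qed.

Lemma int_on_R_shift (t : R) (f : R -> R) : int_on_R f ->
  int_on_R (fun x => f (x - t)).
Proof.
move=> /(int_on_R_reflect 0)/(int_on_R_reflect t).
by under eq_fun do rewrite sub0r opprB.
Qed.

Lemma Rintegral_shift (t : R) (f : R -> R) : int_on_R f ->
  \int[mu]_x f (x - t) = \int[mu]_x f x.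
Proof.
move=> fi; rewrite -(Rintegral_reflect 0 fi).
rewrite -(Rintegral_reflect t (int_on_R_reflect 0 fi)).
by apply: eq_Rintegral => x _; rewrite sub0r opprB.
Qed.

Lemma le_norm_Rintegral (f g : R -> R) : measurable_fun [set: R] f -> int_on_R g ->
  (forall x, `|f x| <= g x) -> `|\int[mu]_x f x| <= \int[mu]_x g x.
Proof.
move=> mf gi fg; have fi := int_on_R_le mf gi fg.
apply: le_trans (le_normr_Rintegral _ fi) _ => //.
by apply: le_Rintegral => //; exact: int_on_R_norm.
Qed.

(** By Tonelli, one finite iterated integral of |h| suffices. Integrability of every section, not
    just of almost every one, identifies the real inner integrals with the extended-real ones
    pointwise. *)
Lemma Rintegral_fubini (h : R -> R -> R) :
  measurable_fun [set: R * R] (fun z => h z.1 z.2) ->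
  (\int[mu]_x \int[mu]_y `|h x y|%:E < +oo)%E ->
  (forall x, int_on_R (h x)) -> (forall y, int_on_R (h ^~ y)) ->
  \int[mu]_x (\int[mu]_y h x y) = \int[mu]_y (\int[mu]_x h x y).
Proof.
move=> mh hy h1 h2; rewrite /Rintegral; congr fine.
under eq_integral do rewrite -/(Rintegral mu setT _) EFin_Rintegral//.
under [RHS]eq_integral do rewrite -/(Rintegral mu setT _) EFin_Rintegral//.
apply: (@Fubini _ _ _ _ R mu mu (fun z => (h z.1 z.2)%:E)).
by apply/integrable12ltyP => //; exact/measurable_EFinP.
Qed.

End RealIntegrals.

(** * Riemann-Liouville kernels and integrals *)

(** The kernel k_nu of the overview. For nu > 0 the factor 1 / Gamma(nu) makes its Laplace transform
    at s equal to s^(-nu), so that convolution adds orders. *)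
HB.lock Definition rl_kernel (R : realType) (nu u : R) : R :=
  pow_pos nu u / Gamma nu.
Arguments rl_kernel {R}.

Section RiemannLiouvilleKernel.
Variable R : realType.
Local Notation mu := (@lebesgue_measure R).

Lemma powR_gt0D (x r t : R) : 0 < x -> x `^ (r + t) = x `^ r * x `^ t.
Proof. by move=> x0; rewrite powRD// (gt_eqF x0) implybT. Qed.

Lemma rl_kernel_def (nu u : R) : rl_kernel nu u = pow_pos nu u / Gamma nu.
Proof. by rewrite rl_kernel.unlock. Qed.

Lemma rl_kernel_le0 (nu u : R) : u <= 0 -> rl_kernel nu u = 0.
Proof. by move=> u0; rewrite !rl_kernel_def /pow_pos ltNge u0/= mul0r. Qed.

Lemma rl_kernelE (nu u : R) : 0 < u -> rl_kernel nu u = u `^ (nu - 1) / Gamma nu.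
Proof. by move=> u0; rewrite !rl_kernel_def /pow_pos u0. Qed.

Lemma rl_kernel_ge0 (nu u : R) : 0 < nu -> 0 <= rl_kernel nu u.
Proof. by move=> n0; rewrite rl_kernel_def mulr_ge0 ?pow_pos_ge0 ?invr_ge0 ?ltW ?Gamma_gt0. Qed.

Lemma measurable_rl_kernel (nu : R) : measurable_fun [set: R] (rl_kernel nu).
Proof.
have -> : rl_kernel nu = (fun u : R => pow_pos nu u / Gamma nu).
  by apply/funext => u; exact: rl_kernel_def.
by apply: measurable_funM => //; exact: measurable_pow_pos.
Qed.

Lemma measurable_expRZ (s : R) : measurable_fun [set: R] (fun u => expR (s * u)).
Proof. by apply: measurableT_comp; [exact: measurable_expR|exact: measurable_funM]. Qed.

Lemma ge0_integral_rl_kernel_expR (nu s : R) : 0 < nu -> 0 < s ->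
  (\int[mu]_u (rl_kernel nu u * expR (- s * u))%:E = (s `^ (- nu))%:E)%E.
Proof.
move=> nu0 s0.
have G0 := Gamma_gt0 nu0.
have mk : measurable_fun [set: R] (fun u => rl_kernel nu u * expR (- s * u)).
  by apply: measurable_funM; [exact: measurable_rl_kernel|exact: measurable_expRZ].
have k0 u : (0 <= (rl_kernel nu u * expR (- s * u))%:E)%E.
  by rewrite lee_fin mulr_ge0 ?rl_kernel_ge0 ?expR_ge0.
have si : 0 < s^-1 by rewrite invr_gt0.
rewrite (ge0_integral_scale si)//; last exact/measurable_EFinP.
have E (u : R) : rl_kernel nu (u * s^-1) * expR (- s * (u * s^-1)) =
    s `^ (1 - nu) / Gamma nu * (pow_pos nu u * expR (- u)).
  rewrite (_ : - s * (u * s^-1) = - u); last by field; rewrite gt_eqF.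
  rewrite !rl_kernel_def /pow_pos pmulr_lgt0//; case: ifPn => [u0|_]; last first.
    by rewrite !(mul0r, mulr0).
  rewrite powRM ?ltW// -powR_inv1 ?ltW// -powRrM mulN1r opprB.
  by field; rewrite gt_eqF.
under eq_integral do rewrite E EFinM.
rewrite ge0_integralZl//=; last 3 first.
- apply/measurable_EFinP/measurable_funM; first exact: measurable_pow_pos.
  by apply: measurableT_comp => //; exact: measurable_expR.
- by move=> u _; rewrite lee_fin mulr_ge0 ?pow_pos_ge0 ?expR_ge0.
- by rewrite lee_fin mulr_ge0 ?powR_ge0 ?invr_ge0 ?ltW.
rewrite integral_pow_pos_expR// -!EFinM divfK ?gt_eqF//.
by rewrite -powR_inv1 ?ltW// -powR_gt0D//; congr ((_ `^ _)%:E); ring.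
Qed.

Lemma int_on_R_rl_kernel_expR (nu s : R) : 0 < nu -> 0 < s ->
  int_on_R (fun u => rl_kernel nu u * expR (- s * u)).
Proof.
move=> nu0 s0; apply: int_on_R_ge0P.
- by apply: measurable_funM; [exact: measurable_rl_kernel|exact: measurable_expRZ].
- by move=> u; rewrite mulr_ge0 ?rl_kernel_ge0 ?expR_ge0.
- by rewrite ge0_integral_rl_kernel_expR// ltry.
Qed.

Lemma Rintegral_rl_kernel_expR (nu s : R) : 0 < nu -> 0 < s ->
  \int[mu]_u (rl_kernel nu u * expR (- s * u)) = s `^ (- nu).
Proof. by move=> nu0 s0; rewrite /Rintegral ge0_integral_rl_kernel_expR. Qed.

(** Extended-real valued, because finiteness comes out only with [rl_conv1]. *)
Definition rl_conv (m n t : R) : \bar R :=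
  (\int[mu]_u (rl_kernel m u * rl_kernel n (t - u))%:E)%E.

Lemma measurable_rl_kernelM (m n : R) :
  measurable_fun [set: R * R] (fun z => rl_kernel m z.1 * rl_kernel n (z.2 - z.1)).
Proof.
apply: measurable_funM.
  by apply: measurableT_comp => //; exact: measurable_rl_kernel.
apply: measurableT_comp; first exact: measurable_rl_kernel.
exact: measurable_funB.
Qed.

Lemma rl_conv_ge0 (m n t : R) : 0 < m -> 0 < n -> (0 <= rl_conv m n t)%E.
Proof. by move=> m0 n0; apply: integral_ge0 => u _; rewrite lee_fin mulr_ge0 ?rl_kernel_ge0. Qed.

Lemma rl_conv_le0 (m n t : R) : t <= 0 -> rl_conv m n t = 0%E.
Proof.
move=> t0; rewrite /rl_conv; apply: integral0_eq => u _; congr EFin.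
have [u0|u0] := leP u 0; first by rewrite rl_kernel_le0// mul0r.
by rewrite (@rl_kernel_le0 n) ?mulr0//; lra.
Qed.

(** Homogeneity of both kernels reduces the convolution to one unknown constant, its value at t = 1,
    so that the Beta integral need not be computed directly. *)
Lemma rl_conv_scale (m n t : R) : 0 < m -> 0 < n -> 0 < t ->
  rl_conv m n t = ((t `^ (m + n - 1))%:E * rl_conv m n 1)%E.
Proof.
move=> m0 n0 t0; rewrite /rl_conv.
have mk x : measurable_fun [set: R] (fun u => (rl_kernel m u * rl_kernel n (x - u))%:E).
  apply/measurable_EFinP/measurable_funM; first exact: measurable_rl_kernel.
  by apply: measurableT_comp; [exact: measurable_rl_kernel|exact: measurable_reflect].
have k0 x u : (0 <= (rl_kernel m u * rl_kernel n (x - u))%:E)%E.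
  by rewrite lee_fin mulr_ge0 ?rl_kernel_ge0.
rewrite (ge0_integral_scale t0 (mk t) (k0 t)).
have S k u : rl_kernel k (u * t) = t `^ (k - 1) * rl_kernel k u.
  rewrite !rl_kernel_def /pow_pos pmulr_lgt0//; case: ifPn => [u0|_].
    by rewrite powRM ?ltW//; ring.
  by rewrite !(mul0r, mulr0).
have E (u : R) : (rl_kernel m (u * t) * rl_kernel n (t - u * t))%:E =
    ((t `^ (m + n - 2))%:E * (rl_kernel m u * rl_kernel n (1 - u))%:E)%E.
  rewrite (_ : t - u * t = (1 - u) * t); last by ring.
  rewrite !S -EFinM; congr EFin.
  have -> : t `^ (m + n - 2) = t `^ (m - 1) * t `^ (n - 1).
    by rewrite -powR_gt0D//; congr (_ `^ _); ring.
  by ring.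
under eq_integral do rewrite E.
rewrite ge0_integralZl//=; [|exact: mk|by rewrite lee_fin powR_ge0].
rewrite muleA -EFinM; congr (EFin _ * _)%E.
by rewrite -[X in X * _]powRr1 ?ltW// -powR_gt0D//; congr (_ `^ _); ring.
Qed.

(* Compare the Laplace transforms at 1 of both sides. *)
Lemma rl_conv1 (m n : R) : 0 < m -> 0 < n -> rl_conv m n 1 = (Gamma (m + n))^-1%:E.
Proof.
move=> m0 n0; have mn0 : 0 < m + n by rewrite addr_gt0.
pose h (u t : R) := (expR (- 1 * t) * (rl_kernel m u * rl_kernel n (t - u)))%:E.
have h0 u t : (0 <= h u t)%E.
  by rewrite lee_fin mulr_ge0 ?expR_ge0// mulr_ge0 ?rl_kernel_ge0.
have mh : measurable_fun [set: R * R] (fun z => h z.1 z.2).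
  apply/measurable_EFinP/measurable_funM; last exact: measurable_rl_kernelM.
  exact: (measurableT_comp (measurable_expRZ (-1)) measurable_snd).
have := @fubini_tonelli _ _ _ _ R mu mu (fun z => h z.1 z.2) mh (fun z => h0 z.1 z.2).
rewrite /= /h.
have -> : (\int[mu]_x \int[mu]_y (expR (-1 * y) * (rl_kernel m x * rl_kernel n (y - x)))%:E = 1)%E.
  transitivity (\int[mu]_u (rl_kernel m u * expR (- 1 * u))%:E)%E; last first.
    by rewrite ge0_integral_rl_kernel_expR// powR1.
  apply: eq_integral => u _.
  have E t : (expR (-1 * t) * (rl_kernel m u * rl_kernel n (t - u)))%:E =
     ((rl_kernel m u * expR (- 1 * u))%:E *
      (rl_kernel n (t - u) * expR (- 1 * (t - u)))%:E)%E.
    rewrite -EFinM; congr EFin.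
    rewrite (_ : expR (- 1 * t) = expR (-1 * u) * expR (- 1 * (t - u))); first by ring.
    by rewrite -expRD; congr expR; ring.
  under eq_integral do rewrite E.
  have mk : measurable_fun [set: R] (fun x => (rl_kernel n x * expR (- 1 * x))%:E).
    apply/measurable_EFinP/measurable_funM; first exact: measurable_rl_kernel.
    exact: measurable_expRZ.
  have k0 x : (0 <= (rl_kernel n x * expR (- 1 * x))%:E)%E.
    by rewrite lee_fin mulr_ge0 ?rl_kernel_ge0 ?expR_ge0.
  rewrite ge0_integralZl//=; last 2 first.
  - apply: (measurableT_comp mk); exact: measurable_funB.
  - by rewrite lee_fin mulr_ge0 ?rl_kernel_ge0 ?expR_ge0.
  by rewrite (ge0_integral_shift u mk k0) ge0_integral_rl_kernel_expR// powR1 mule1.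
have -> : (\int[mu]_y \int[mu]_x (expR (-1 * y) * (rl_kernel m x * rl_kernel n (y - x)))%:E =
    \int[mu]_t ((pow_pos (m + n) t * expR (- t))%:E * rl_conv m n 1))%E.
  apply: eq_integral => t _.
  under eq_integral do rewrite EFinM.
  rewrite ge0_integralZl//=; last 2 first.
  - apply/measurable_EFinP/measurable_funM; first exact: measurable_rl_kernel.
    by apply: measurableT_comp; [exact: measurable_rl_kernel|exact: measurable_reflect].
  - by move=> u _; rewrite lee_fin mulr_ge0 ?rl_kernel_ge0.
  rewrite -/(rl_conv m n t) mulN1r /pow_pos.
  have [t0|t0] := leP t 0.
    by rewrite rl_conv_le0// mul0r mul0e mule0.
  by rewrite rl_conv_scale// muleA -EFinM mulrC.
rewrite ge0_integralZr//=; last 3 first.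
- apply/measurable_EFinP/measurable_funM; first exact: measurable_pow_pos.
  by apply: measurableT_comp => //; exact: measurable_expR.
- by move=> t _; rewrite lee_fin mulr_ge0 ?pow_pos_ge0 ?expR_ge0.
- exact: rl_conv_ge0.
rewrite integral_pow_pos_expR//.
have G0 := Gamma_gt0 mn0.
(* The comparison reads 1 = Gamma(m + n) times the constant, with Gamma(m + n) > 0; this excludes an
   infinite constant. *)
case: (rl_conv m n 1) (rl_conv_ge0 1 m0 n0) => [r _ | _ | //].
  by rewrite -EFinM => -[] r1; congr EFin; rewrite -[RHS]mul1r r1 mulrAC divff ?mul1r// gt_eqF.
by rewrite gt0_muley ?lte_fin.
Qed.

Lemma ge0_integral_rl_kernel_conv (m n t : R) : 0 < m -> 0 < n ->
  (\int[mu]_u (rl_kernel m u * rl_kernel n (t - u))%:E = (rl_kernel (m + n) t)%:E)%E.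
Proof.
move=> m0 n0; rewrite -/(rl_conv m n t).
have [t0|t0] := leP t 0; first by rewrite rl_conv_le0// rl_kernel_le0.
by rewrite rl_conv_scale// rl_conv1// -EFinM rl_kernelE.
Qed.

Lemma int_on_R_rl_kernel_conv (m n t : R) : 0 < m -> 0 < n ->
  int_on_R (fun u => rl_kernel m u * rl_kernel n (t - u)).
Proof.
move=> m0 n0; apply: int_on_R_ge0P.
- apply: measurable_funM; first exact: measurable_rl_kernel.
  by apply: measurableT_comp; [exact: measurable_rl_kernel|exact: measurable_reflect].
- by move=> u; rewrite mulr_ge0 ?rl_kernel_ge0.
- by rewrite ge0_integral_rl_kernel_conv// ltry.
Qed.

End RiemannLiouvilleKernel.

(** The operator J^m of the overview. As a convolution over the whole line it has base point -oo; on
    causal functions this is the Riemann-Liouville integral with base point 0. *)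
HB.lock Definition rl_int (R : realType) (m : R) (y : R -> R) (t : R) : R :=
  \int[@lebesgue_measure R]_u (rl_kernel m u * y (t - u)).
Arguments rl_int {R}.

(** * Fractional integrals of causal functions of exponential growth *)

Section FractionalIntegral.
Variable R : realType.
Local Notation mu := (@lebesgue_measure R).

Lemma rl_intE (m : R) (y : R -> R) (t : R) :
  rl_int m y t = \int[mu]_u (rl_kernel m u * y (t - u)).
Proof. by rewrite rl_int.unlock. Qed.

Definition causal (y : R -> R) := forall t : R, t <= 0 -> y t = 0.

Definition exp_le (s C : R) (y : R -> R) :=
  forall t : R, `|y t| <= C * expR (s * t).

Definition exp_cont (s : R) (y : R -> R) :=
  continuous y /\ exists C, exp_le s C y.

Lemma exp_le_ge0 s C y : exp_le s C y -> 0 <= C.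
Proof.
move=> /(_ 0); rewrite mulr0 expR0 mulr1; exact: le_trans.
Qed.

Lemma measurable_rl_integrand m (y : R -> R) t : measurable_fun [set: R] y ->
  measurable_fun [set: R] (fun u => rl_kernel m u * y (t - u)).
Proof.
move=> my; apply: measurable_funM; first exact: measurable_rl_kernel.
by apply: measurableT_comp my _; exact: measurable_reflect.
Qed.

Lemma rl_integrand_le m s C y t u : 0 < m -> exp_le s C y ->
  `|rl_kernel m u * y (t - u)| <= C * expR (s * t) * (rl_kernel m u * expR (- s * u)).
Proof.
move=> m0 yC; rewrite normrM ger0_norm ?rl_kernel_ge0// mulrCA.
apply: ler_wpM2l; first exact: rl_kernel_ge0.
rewrite -mulrA -expRD (_ : s * t + - s * u = s * (t - u)); last by ring.
exact: yC.
Qed.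

Lemma int_on_R_rl_exp m s C y t : 0 < m -> 0 < s -> measurable_fun [set: R] y ->
  exp_le s C y -> int_on_R (fun u => rl_kernel m u * y (t - u)).
Proof.
move=> m0 s0 my yC.
apply: (@int_on_R_le _ _ (fun u => C * expR (s * t) * (rl_kernel m u * expR (- s * u)))).
- exact: measurable_rl_integrand.
- by apply: int_on_RZ; exact: int_on_R_rl_kernel_expR.
- by move=> u; exact: rl_integrand_le.
Qed.

(** Convolution with k_m multiplies the weighted norm by at most the Laplace transform of k_m at s.
    This factor becomes small for large s and is the source of the contraction. *)
Lemma rl_int_exp_le m s C y : 0 < m -> 0 < s -> measurable_fun [set: R] y ->
  exp_le s C y -> exp_le s (s `^ (- m) * C) (rl_int m y).
Proof.
move=> m0 s0 my yC t; rewrite rl_intE.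
apply: (@le_trans _ _ (\int[mu]_u (C * expR (s * t) * (rl_kernel m u * expR (- s * u))))).
  apply: le_norm_Rintegral.
  - exact: measurable_rl_integrand.
  - by apply: int_on_RZ; exact: int_on_R_rl_kernel_expR.
  - by move=> u; exact: rl_integrand_le.
rewrite RintegralZl//; last exact: int_on_R_rl_kernel_expR.
by rewrite Rintegral_rl_kernel_expR// le_eqVlt; apply/orP; left; apply/eqP; ring.
Qed.

Lemma continuous_rl_int m s y : 0 < m -> 0 < s -> exp_cont s y ->
  continuous (rl_int m y).
Proof.
move=> m0 s0 [cy [C yC]] x.
have -> : rl_int m y = (fun t => \int[mu]_u (rl_kernel m u * y (t - u))).
  by apply/funext => t; rewrite rl_intE.
have C0 := exp_le_ge0 yC.
have my := continuous_measurable_fun cy.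
(* Dominated convergence on ]x - 1, x + 1[, where the growth factor e^(s t) is at most e^(s (x +
   1)). *)
have := @continuity_under_integral R _ _ mu (fun t u => rl_kernel m u * y (t - u))
  setT measurableT (x - 1) (x + 1) _ _
  (fun u => C * expR (s * (x + 1)) * (rl_kernel m u * expR (- s * u))).
move=> /(_ _ _ _ _)/wrap[]; last first.
  apply; rewrite inE/= in_itv/=; apply/andP; split; lra.
- move=> t; rewrite /= in_itv/= => /andP[_ tx]; apply/aeW => u _.
  apply: le_trans (rl_integrand_le _ _ m0 yC) _.
  apply: ler_wpM2r; first by rewrite mulr_ge0 ?rl_kernel_ge0 ?expR_ge0.
  by rewrite ler_wpM2l// ler_expR ler_wpM2l// ltW.
- by apply: int_on_RZ; exact: int_on_R_rl_kernel_expR.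
- apply/aeW => u _ t _; apply: cvgM; first exact: cvg_cst.
  apply: (@cvg_comp _ _ _ (fun t => t - u) y); last exact: cy.
  by apply: cvgB; [exact: cvg_id|exact: cvg_cst].
- by move=> t _; exact: int_on_R_rl_exp yC.
Qed.

Lemma exp_cont_rl_int m s y : 0 < m -> 0 < s -> exp_cont s y ->
  exp_cont s (rl_int m y).
Proof.
move=> m0 s0 ey; split; first exact: continuous_rl_int ey.
case: ey => cy [C yC]; exists (s `^ (- m) * C).
by apply: rl_int_exp_le => //; exact: continuous_measurable_fun.
Qed.

Lemma exp_cont_lin s (k : R) (y z : R -> R) : exp_cont s y -> exp_cont s z ->
  exp_cont s (fun t => k * y t + z t).
Proof.
move=> [cy [C yC]] [cz [D zD]]; split.
  by move=> t; apply: cvgD; [apply: cvgM; [exact: cvg_cst|exact: cy]|exact: cz].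
exists (`|k| * C + D) => t; rewrite mulrDl (le_trans (ler_normD _ _))// lerD//.
by rewrite normrM -mulrA ler_wpM2l.
Qed.

Lemma exp_cont_shift s (tau : R) (y : R -> R) : exp_cont s y ->
  exp_cont s (fun t => y (t - tau)).
Proof.
move=> [cy [C yC]]; split.
  move=> t; apply: (@cvg_comp _ _ _ (fun t => t - tau) y); last exact: cy.
  by apply: cvgB; [exact: cvg_id|exact: cvg_cst].
exists (C * expR (- s * tau)) => t; rewrite -mulrA -expRD.
by rewrite (_ : - s * tau + s * t = s * (t - tau)); last by ring.
Qed.

Lemma rl_int_shift m (tau : R) (y : R -> R) :
  rl_int m (fun t => y (t - tau)) = (fun t => rl_int m y (t - tau)).
Proof.
apply/funext => t; rewrite !rl_intE; apply: eq_Rintegral => u _.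
by congr (_ * y _); ring.
Qed.

Lemma rl_int_causal m y : causal y -> causal (rl_int m y).
Proof.
move=> y0 t t0; rewrite rl_intE (@eq_Rintegral _ _ _ _ _ (fun=> 0)).
  by rewrite Rintegral_cst// mul0r.
move=> u _; have [u0|u0] := leP u 0; first by rewrite rl_kernel_le0// mul0r.
by rewrite y0 ?mulr0//; lra.
Qed.

Lemma rl_int_kernel (m n : R) : 0 < m -> 0 < n ->
  rl_int m (rl_kernel n) = rl_kernel (m + n) :> (R -> R).
Proof.
move=> m0 n0; apply/funext => t.
by rewrite rl_intE /Rintegral ge0_integral_rl_kernel_conv.
Qed.

(** Once the inner variable is shifted by u, the factor y(t - r) is independent of u, and Fubini
    leaves the convolution of k_m and k_n. *)
Lemma rl_int_exp_semigroup m n s y : 0 < m -> 0 < n -> 0 < s -> exp_cont s y ->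
  rl_int m (rl_int n y) = rl_int (m + n) y.
Proof.
move=> m0 n0 s0 [cy [C yC]]; apply/funext => t.
have C0 := exp_le_ge0 yC.
have my := continuous_measurable_fun cy.
pose h (u r : R) := rl_kernel m u * rl_kernel n (r - u) * y (t - r).
have inner u : int_on_R (fun r => rl_kernel n (r - u) * y (t - r)).
  have := int_on_R_shift u (int_on_R_rl_exp (t - u) n0 s0 my yC).
  by apply: eq_int_on_R => r; congr (_ * y _); ring.
have E1 : rl_int m (rl_int n y) t = \int[mu]_u (\int[mu]_r h u r).
  rewrite rl_intE; apply: eq_Rintegral => u _; rewrite /h.
  under [RHS]eq_Rintegral do rewrite -mulrA.
  rewrite RintegralZl//; last exact: inner.
  congr (_ * _).
  rewrite rl_intE -(Rintegral_shift u (int_on_R_rl_exp (t - u) n0 s0 my yC)).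
  by apply: eq_Rintegral => r _; congr (_ * y _); ring.
have E2 : rl_int (m + n) y t = \int[mu]_r (\int[mu]_u h u r).
  rewrite rl_intE; apply: eq_Rintegral => r _; rewrite /h RintegralZr//.
    by rewrite /Rintegral ge0_integral_rl_kernel_conv.
  exact: int_on_R_rl_kernel_conv.
have mh : measurable_fun [set: R * R] (fun z => h z.1 z.2).
  apply: measurable_funM; first exact: (measurable_rl_kernelM m n).
  apply: (measurableT_comp my); exact: (measurableT_comp (measurable_reflect t) measurable_snd).
(* Splitting e^(s (t - r)) into e^(s t) e^(-s u) e^(-s (r - u)) gives each kernel its own decaying
   weight, so the majorant can be integrated in r and then in u. *)
have hle u r : `|h u r| <= C * expR (s * t) * (rl_kernel m u * expR (- s * u)) *
    (rl_kernel n (r - u) * expR (- s * (r - u))).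
  have := @rl_integrand_le n s C y (t - u) (r - u) n0 yC.
  rewrite (_ : t - u - (r - u) = t - r); last by ring.
  move=> /(ler_wpM2l (rl_kernel_ge0 u m0)).
  have -> : `|h u r| = rl_kernel m u * `|rl_kernel n (r - u) * y (t - r)|.
    by rewrite /h -mulrA normrM (ger0_norm (rl_kernel_ge0 u m0)).
  move=> /le_trans; apply.
  rewrite (_ : s * (t - u) = s * t + - s * u); last by ring.
  by rewrite expRD le_eqVlt; apply/orP; left; apply/eqP; ring.
have inth : (\int[mu]_u \int[mu]_r `|h u r|%:E < +oo)%E.
  have Di := int_on_RZ (s `^ (- n) * (C * expR (s * t))) (int_on_R_rl_kernel_expR m0 s0).
  move: (int_on_R_lty Di); apply: le_lt_trans; apply: ge0_le_integral => //=.
  - by move=> u _; apply: integral_ge0 => r _; rewrite lee_fin.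
  - apply: (@measurable_fun_fubini_tonelli_F _ _ _ _ R mu (fun z => `|h z.1 z.2|%:E)) => //.
    by apply/measurable_EFinP; apply: measurableT_comp.
  - by apply/measurable_EFinP; apply: measurableT_comp => //; exact: int_on_R_measurable.
  - move=> u _.
    have k0 x : (0 <= (rl_kernel n x * expR (- s * x))%:E)%E.
      by rewrite lee_fin mulr_ge0 ?rl_kernel_ge0 ?expR_ge0.
    have mk := (measurable_EFinP _ _).2 (int_on_R_measurable (int_on_R_rl_kernel_expR n0 s0)).
    have D0 : 0 <= C * expR (s * t) * (rl_kernel m u * expR (- s * u)).
      apply: mulr_ge0; first by apply: mulr_ge0; [exact: C0|exact: expR_ge0].
      by apply: mulr_ge0; [exact: rl_kernel_ge0|exact: expR_ge0].
    apply: (@le_trans _ _ (\int[mu]_r ((C * expR (s * t) * (rl_kernel m u * expR (- s * u)))%:E *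
        (rl_kernel n (r - u) * expR (- s * (r - u)))%:E))%E).
      apply: ge0_le_integral => //=.
      + apply/measurable_EFinP; apply: measurableT_comp => //.
        exact: (measurableT_comp mh (pair1_measurable u)).
      + apply: emeasurable_funM => //; apply: (measurableT_comp mk); exact: measurable_funB.
      + by move=> r _; rewrite -EFinM lee_fin.
    rewrite ge0_integralZl//=; last first.
      apply: (measurableT_comp mk); exact: measurable_funB.
    rewrite (ge0_integral_shift u mk k0) ge0_integral_rl_kernel_expR// -EFinM lee_fin.
    by apply: le_trans (ler_norm _); rewrite le_eqVlt; apply/orP; left; apply/eqP; ring.
rewrite E1 E2; apply: Rintegral_fubini => //.
- by move=> u; rewrite /h; under eq_fun do rewrite -mulrA; exact: int_on_RZ.
- move=> r; rewrite /h; under eq_fun do rewrite mulrC; apply: int_on_RZ.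
  exact: int_on_R_rl_kernel_conv.
Qed.

Lemma Gamma1 : Gamma (1 : R) = 1.
Proof.
rewrite /Gamma /Rintegral -[RHS]/(fine 1%:E); congr fine.
rewrite -(@integral_exponential_pdf R 1 ltr01) integral_itv_obnd_cbnd; last first.
  apply/measurable_EFinP/measurable_funTS/measurable_funM.
    exact: measurable_powR.
  by apply: measurableT_comp => //; exact: measurable_expR.
rewrite integral_mkcond; apply: eq_integral => u _; rewrite /exponential_pdf !patchE.
case: ifP => // _.
by rewrite subrr powRr0 !mul1r mulN1r.
Qed.

Lemma rl_kernel1 (u : R) : rl_kernel 1 u = if 0 < u then 1 else 0.
Proof. by rewrite rl_kernel_def /pow_pos Gamma1 divr1 subrr powRr0. Qed.

Definition rl_integrable (y : R -> R) := forall m t : R, 0 < m ->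
  int_on_R (fun u => rl_kernel m u * y (t - u)).

Lemma integrable_rl1 (y : R -> R) (t : R) : rl_integrable y ->
  mu.-integrable `]-oo, t] (EFin \o y).
Proof.
(* The kernel k_1 is the indicator of the positive half-line; taken at t + 1 it cuts out ]-oo, t +
   1[, which contains the closed half-line up to t. *)
move=> yi; have := int_on_R_reflect (t + 1) (yi 1 (t + 1) ltr01).
have : int_on_R (y \_ `]-oo, t + 1[) -> mu.-integrable `]-oo, t] (EFin \o y).
  rewrite /int_on_R -restrict_EFin => yt.
  have {}yt : mu.-integrable `]-oo, t + 1[ (EFin \o y) by apply/integrable_mkcond.
  apply: integrableS yt => // r; rewrite /= !in_itv/= => rt; lra.
move=> h k; apply: h; move: k; apply: eq_int_on_R => r.
rewrite rl_kernel1 subr_gt0 patchE mem_setE in_itv/= subKr.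
by case: ifP; rewrite ?mul1r ?mul0r.
Qed.

Lemma rl_int1E (y : R -> R) (t : R) : rl_integrable y ->
  rl_int 1 y t = \int[mu]_(r in `]-oo, t]) y r.
Proof.
move=> yi; rewrite rl_intE -(Rintegral_reflect t (yi 1 t ltr01)).
transitivity (\int[mu]_(r in `]-oo, t[) y r).
  rewrite [RHS]Rintegral_mkcond; apply: eq_Rintegral => r _.
  rewrite rl_kernel1 subr_gt0 patchE mem_setE in_itv/= subKr.
  by case: ifP; rewrite ?mul1r ?mul0r.
apply: Rintegral_itv_bndo_bndc.
apply: integrableS (integrable_rl1 t yi) => // r; rewrite /= !in_itv/=; exact: ltW.
Qed.

Lemma is_derive_rl_int1 (y : R -> R) (t : R) : rl_integrable y ->
  {for t, continuous y} -> is_derive t 1 (rl_int 1 y) (y t).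
Proof.
move=> yi cy.
have [d1 d2] := @continuous_FTC1 R y -oo%O t (t + 1) ltac:(lra)
  (integrable_rl1 (t + 1) yi) (ltNyr _) cy.
have -> : rl_int 1 y = (fun x => \int[mu]_(r in `]-oo, x]) y r).
  by apply/funext => x; exact: rl_int1E.
by split; [exact: d1|rewrite -derive1E].
Qed.

Lemma rl_integrable_lin (k : R) (y z : R -> R) : rl_integrable y -> rl_integrable z ->
  rl_integrable (fun t => k * y t + z t).
Proof.
move=> iy iz m t m0.
apply: eq_int_on_R (int_on_RD (int_on_RZ k (iy m t m0)) (iz m t m0)) => u.
by ring.
Qed.

(* The kernels of order nu <= 1 do not belong to [exp_cont s]: they are singular
   or jump at 0. *)
Inductive nice (s : R) : (R -> R) -> Prop :=
| nice_kernel nu : 0 < nu -> nice s (rl_kernel nu)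
| nice_exp y : exp_cont s y -> causal y -> nice s y
| nice_lin k y z : nice s y -> nice s z -> nice s (fun t => k * y t + z t).

Lemma nice_rl_integrable s y : 0 < s -> nice s y -> rl_integrable y.
Proof.
move=> s0; elim=> [nu nu0|{}y [cy [C yC]] _|k {}y z _ iy _ iz].
- by move=> m t m0; exact: int_on_R_rl_kernel_conv.
- by move=> m t m0; apply: int_on_R_rl_exp yC => //; exact: continuous_measurable_fun.
- exact: rl_integrable_lin.
Qed.

Lemma rl_int_lin m (k : R) (y z : R -> R) : 0 < m -> rl_integrable y -> rl_integrable z ->
  rl_int m (fun t => k * y t + z t) = (fun t => k * rl_int m y t + rl_int m z t).
Proof.
move=> m0 iy iz; apply/funext => t; rewrite !rl_intE.
rewrite -RintegralZl//; last exact: (iy m t m0).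
rewrite -RintegralD//; [|exact: int_on_RZ (iy m t m0)|exact: (iz m t m0)].
by apply: eq_Rintegral => u _; ring.
Qed.

Lemma nice_causal s y : nice s y -> causal y.
Proof.
elim=> [nu nu0|{}y _ //|k {}y z _ cy _ cz] t t0; first exact: rl_kernel_le0.
by rewrite cy// cz// mulr0 addr0.
Qed.

Lemma continuous_rl_kernel_pos (nu t : R) : 0 < t -> {for t, continuous (rl_kernel nu)}.
Proof.
move=> t0; have c : {for t, continuous (fun u : R => u `^ (nu - 1) / Gamma nu)}.
  by apply: cvgM; [exact: continuous_powR_pos|exact: cvg_cst].
rewrite /prop_for /continuous_at rl_kernelE//.
apply: cvg_trans c; apply: near_eq_cvg.
by near=> u; rewrite rl_kernelE//; near: u; exact: lt_nbhsr.
Unshelve. all: by end_near. Qed.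

Lemma nice_continuous s y (t : R) : nice s y -> 0 < t -> {for t, continuous y}.
Proof.
move=> ny t0; elim: ny => [nu _|{}y [cy _] _|k {}y z _ cy _ cz].
- exact: continuous_rl_kernel_pos.
- exact: cy.
- by apply: cvgD; [apply: cvgM; [exact: cvg_cst|exact: cy]|exact: cz].
Qed.

Lemma nice_rl_int m s y : 0 < m -> 0 < s -> nice s y -> nice s (rl_int m y).
Proof.
move=> m0 s0; elim=> [nu nu0|{}y ey cy|k {}y z ny iy nz iz].
- by rewrite rl_int_kernel//; apply: nice_kernel; exact: addr_gt0.
- by apply: nice_exp; [exact: exp_cont_rl_int|exact: rl_int_causal].
- rewrite rl_int_lin//; [exact: nice_lin|exact: nice_rl_integrable ny|].
  exact: nice_rl_integrable nz.
Qed.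

Lemma rl_int_semigroup m n s y : 0 < m -> 0 < n -> 0 < s -> nice s y ->
  rl_int m (rl_int n y) = rl_int (m + n) y.
Proof.
move=> m0 n0 s0; elim=> [nu nu0|{}y ey cy|k {}y z ny iy nz iz].
- by rewrite !rl_int_kernel// ?addr_gt0// addrA.
- exact: rl_int_exp_semigroup ey.
- have mn0 := addr_gt0 m0 n0.
  have [iny inz] := (nice_rl_integrable s0 ny, nice_rl_integrable s0 nz).
  have inY := nice_rl_integrable s0 (nice_rl_int n0 s0 ny).
  have inZ := nice_rl_integrable s0 (nice_rl_int n0 s0 nz).
  by rewrite !rl_int_lin// iy iz.
Qed.

Lemma continuous_rl_kernel (nu : R) : 1 < nu -> continuous (rl_kernel nu).
Proof.
move=> nu1 t; have [t0|t0|->] := ltgtP t 0.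
- rewrite /continuous_at rl_kernel_le0 ?ltW//.
  apply: cvg_near_cst.
  by near=> u; rewrite rl_kernel_le0// ltW//; near: u; exact: lt_nbhsl.
- exact: continuous_rl_kernel_pos.
- apply/left_right_continuousP; split; rewrite rl_kernel_le0//.
    apply: cvg_near_cst.
    by near=> u; rewrite rl_kernel_le0// ltW.
  have c : (fun u : R => u `^ (nu - 1) / Gamma nu) @ 0^'+ --> (0 : R).
    rewrite -[X in _ --> X](mul0r (Gamma nu)^-1).
    apply: cvgM; last exact: cvg_cst.
    by apply: powR_cvg0; rewrite subr_gt0.
  apply: cvg_trans c; apply: near_eq_cvg.
  by near=> u; rewrite rl_kernelE.
Unshelve. all: by end_near. Qed.

Lemma exp_cont_rl_kernel (s nu : R) : 0 < s -> 1 < nu -> exp_cont s (rl_kernel nu).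
Proof.
move=> s0 nu1; split; first exact: continuous_rl_kernel.
have nu0 : 0 < nu by lra.
have [C C0 hC] := @powR_le_expR R (nu - 1) s ltac:(lra) s0.
exists (C / Gamma nu) => t; have [t0|t0] := leP t 0.
  by rewrite rl_kernel_le0// normr0 !mulr_ge0 ?expR_ge0 ?invr_ge0 ?ltW ?Gamma_gt0.
rewrite ger0_norm ?rl_kernel_ge0// rl_kernelE// mulrAC ler_wpM2r ?hC//.
by rewrite invr_ge0 ltW ?Gamma_gt0.
Qed.

(** An integration of order at least 1 lifts every kernel to an order above 1, where it is
    continuous at 0. *)
Lemma exp_cont_rl_int_nice s m y : 1 <= m -> 0 < s -> nice s y -> exp_cont s (rl_int m y).
Proof.
move=> m1 s0; have m0 : 0 < m by lra.
elim=> [nu nu0|{}y ey cy|k {}y z ny iy nz iz].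
- by rewrite rl_int_kernel//; apply: exp_cont_rl_kernel => //; lra.
- exact: exp_cont_rl_int.
- rewrite rl_int_lin//; [exact: exp_cont_lin|exact: nice_rl_integrable ny|].
  exact: nice_rl_integrable nz.
Qed.

Lemma rl_int_derive s y (t : R) : 0 < s -> nice s y -> 0 < t ->
  is_derive t 1 (rl_int 1 y) (y t).
Proof.
move=> s0 ny t0; apply: is_derive_rl_int1; first exact: nice_rl_integrable ny.
exact: nice_continuous ny t0.
Qed.

End FractionalIntegral.

(** * The Volterra equation *)

Section Volterra.
Variable R : realType.
Local Notation mu := (@lebesgue_measure R).

Lemma half_exp_small (K e : R) : 0 < e -> exists n : nat, K * 2^-1 ^+ n < e.
Proof.
(* Any n with K / e < n + 1 works, since n + 1 <= 2^n. *)
move=> e0; exists (Num.truncn (K / e)).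
set n := Num.truncn _.
rewrite exprVn ltr_pdivrMr ?exprn_gt0// mulrC -ltr_pdivrMr//.
apply: lt_le_trans (truncnS_gt (K / e)) _.
by rewrite -natrX ler_nat ltn_expl.
Qed.

(** Nested intervals: the intervals u_n +- 2 M 2^(-n) decrease, and the supremum of their left ends
    lies in all of them. *)
Lemma geometric_seq_limit (M : R) (u : nat -> R) :
  (forall n, `|u n.+1 - u n| <= M * 2^-1 ^+ n) ->
  exists l : R, forall n, `|l - u n| <= 2 * M * 2^-1 ^+ n.
Proof.
move=> hu; have M0 : 0 <= M.
  by have := hu 0; rewrite expr0 mulr1; exact: le_trans.
pose v n := u n + 2 * M * 2^-1 ^+ n; pose w n := u n - 2 * M * 2^-1 ^+ n.
have vS n : v n.+1 <= v n.
  by rewrite /v exprS; have := hu n; rewrite ler_norml => /andP[_ h]; nra.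
have wS n : w n <= w n.+1.
  by rewrite /w exprS; have := hu n; rewrite ler_norml => /andP[h _]; nra.
have vle m n : (m <= n)%N -> v n <= v m.
  by move=> mn; have /nonincreasing_seqP := vS; apply.
have wle m n : (m <= n)%N -> w m <= w n.
  by move=> mn; have /nondecreasing_seqP := wS; apply.
have wv m n : w m <= v n.
  apply: (@le_trans _ _ (w (maxn m n))); first by rewrite wle// leq_maxl.
  apply: (@le_trans _ _ (v (maxn m n))); last by rewrite vle// leq_maxr.
  rewrite /w /v; have : 0 <= 2 * M * 2^-1 ^+ maxn m n.
    by rewrite mulr_ge0 ?mulr_ge0// exprn_ge0.
  lra.
have sw : has_sup (range w).
  split; first by exists (w 0%N), 0%N.
  by exists (v 0%N) => _ [m _ <-].
exists (sup (range w)) => n; rewrite ler_norml; apply/andP; split.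
  have : w n <= sup (range w) by apply: sup_upper_bound => //; exists n.
  by rewrite /w; lra.
have : sup (range w) <= v n.
  by apply: sup_le_ub; [case: sw|move=> _ [m _ <-]].
by rewrite /v; lra.
Qed.

Lemma exp_cont_cst0 s : exp_cont s (fun _ : R => 0 : R).
Proof.
split; first by move=> t; exact: cvg_cst.
by exists 0 => t; rewrite normr0 mul0r.
Qed.

Lemma exp_cont_scale s (k : R) (y : R -> R) : exp_cont s y ->
  exp_cont s (fun t => k * y t).
Proof.
move=> ey; have := exp_cont_lin k ey (exp_cont_cst0 s).
by under eq_fun do rewrite addr0.
Qed.

Lemma exp_cont_rl_integrable s (y : R -> R) : 0 < s -> exp_cont s y -> rl_integrable y.
Proof.
move=> s0 [cy [C yC]] m t m0.
by apply: int_on_R_rl_exp yC => //; exact: continuous_measurable_fun.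
Qed.

(** The weight e^(s r) is bounded on ]-oo, t + 1], so convergence is uniform near t and a three-term
    estimate applies. *)
Lemma exp_cont_uniform_limit s C (P : nat -> R -> R) (y : R -> R) : 0 < s ->
  (forall n, continuous (P n)) ->
  (forall n t, `|y t - P n t| <= C * 2^-1 ^+ n * expR (s * t)) -> continuous y.
Proof.
move=> s0 cP yP t; apply/cvgrPdist_lt => e e0.
have [n hn] := half_exp_small (C * expR (s * (t + 1))) (e := e / 3) ltac:(lra).
have C0 : 0 <= C.
  have := yP 0%N 0; rewrite expr0 mulr1 mulr0 expR0 mulr1; exact: le_trans.
have bd r : r <= t + 1 -> `|y r - P n r| < e / 3.
  move=> rt; apply: le_lt_trans (yP n r) _; apply: le_lt_trans hn.
  rewrite mulrAC ler_wpM2r ?exprn_ge0// ler_wpM2l// ler_expR ler_wpM2l//.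
  exact: ltW.
have cn : \forall r \near t, `|P n t - P n r| < e / 3.
  by have /cvgrPdist_lt := cP n t; apply; lra.
near=> r.
have rt : r <= t + 1 by rewrite ltW//; near: r; apply: lt_nbhsl; lra.
have h1 := bd t ltac:(lra); have h2 := bd r rt.
have h3 : `|P n t - P n r| < e / 3 by near: r.
rewrite (_ : y t - y r = (y t - P n t) + (P n t - P n r) - (y r - P n r)); last by ring.
have := ler_normB (y t - P n t + (P n t - P n r)) (y r - P n r).
have := ler_normD (y t - P n t) (P n t - P n r).
lra.
Unshelve. all: by end_near. Qed.

Section Solve.
Variables (alpha a b c tau : R).
Hypotheses (alpha0 : 0 < alpha) (c0 : c != 0) (tau0 : 0 <= tau).

Definition volterra_op (y : R -> R) (t : R) : R :=
  c * y t + rl_int alpha y t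
  - a * rl_int (2 * alpha) y t - b * rl_int (2 * alpha) y (t - tau).

(** The fixed-point form of the equation: V y = f exactly when y = f / c + [volterra_step] y, as V y
    = c (y - [volterra_step] y). *)
Definition volterra_step (y : R -> R) (t : R) : R :=
  - c^-1 * (rl_int alpha y t - a * rl_int (2 * alpha) y t
            - b * rl_int (2 * alpha) y (t - tau)).

Let alpha20 : 0 < 2 * alpha.
Proof. by rewrite mulr_gt0. Qed.

Lemma volterra_opE y t : volterra_op y t = c * (y t - volterra_step y t).
Proof. rewrite /volterra_op /volterra_step.
by field. Qed.

Lemma volterra_step_lin k y z : rl_integrable y -> rl_integrable z ->
  volterra_step (fun t => k * y t + z t) = (fun t => k * volterra_step y t + volterra_step z t).
Proof.
move=> iy iz; apply/funext => t.
rewrite /volterra_step (rl_int_lin k alpha0 iy iz) (rl_int_lin k alpha20 iy iz).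
by ring.
Qed.

Lemma volterra_step_causal y : causal y -> causal (volterra_step y).
Proof.
move=> cy t t0; rewrite /volterra_step !(rl_int_causal _ cy)//.
  by rewrite !mulr0 !subr0 mulr0.
by rewrite (le_trans _ t0)// gerBl.
Qed.

Lemma exp_cont_volterra_step s y : 0 < s -> exp_cont s y -> exp_cont s (volterra_step y).
Proof.
move=> s0 ey.
have e1 := exp_cont_rl_int alpha0 s0 ey.
have e2 := exp_cont_rl_int alpha20 s0 ey.
have := exp_cont_scale (- c^-1)
  (exp_cont_lin (- a) e2 (exp_cont_lin (- b) (exp_cont_shift tau e2) e1)).
by congr exp_cont; apply/funext => t; rewrite /volterra_step; ring.
Qed.

Lemma volterra_step_contraction : exists2 s, 0 < s & forall y C, measurable_fun [set: R] y ->
  exp_le s C y -> exp_le s (C / 2) (volterra_step y).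
Proof.
(* Chosen so that (1 + |a| + |b|) / (|c| K) = 1/2. *)
pose K := 2 * (1 + `|a| + `|b|) / `|c|.
have nc0 : 0 < `|c| by rewrite normr_gt0.
have na0 := normr_ge0 a; have nb0 := normr_ge0 b.
have K0 : 0 < K by rewrite divr_gt0//; lra.
(* s >= K^(1/alpha) gives s^(-alpha) <= 1/K, and s >= 1 extends this to s^(-2 alpha). The delay
   costs nothing, because e^(-s tau) <= 1. *)
pose s := Num.max 1 (K `^ alpha^-1).
have s1 : 1 <= s by rewrite /s le_max lexx.
have s0 : 0 < s by lra.
have sK : s `^ (- alpha) <= K^-1.
  rewrite powRN lef_pV2 ?posrE ?powR_gt0//.
  apply: (@le_trans _ _ ((K `^ alpha^-1) `^ alpha)).
    by rewrite -powRrM mulVf ?gt_eqF// powRr1// ltW.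
  apply: ge0_ler_powR; [exact: ltW|by rewrite nnegrE powR_ge0|by rewrite nnegrE ltW|].
  by rewrite /s le_max lexx orbT.
have s2 : s `^ (- (2 * alpha)) <= s `^ (- alpha).
  by apply: ler_powR => //; rewrite lerN2; apply: ler_peMl; [exact: ltW|exact: ler1n].
exists s => // y C my yC t.
have C0 := exp_le_ge0 yC.
have e1 := rl_int_exp_le alpha0 s0 my yC t.
have e2 := rl_int_exp_le alpha20 s0 my yC t.
have e3 : `|rl_int (2 * alpha) y (t - tau)| <= s `^ (- (2 * alpha)) * C * expR (s * t).
  apply: le_trans (rl_int_exp_le alpha20 s0 my yC (t - tau)) _.
  apply: ler_wpM2l; first by rewrite mulr_ge0 ?powR_ge0.
  by rewrite ler_expR; apply: ler_wpM2l; [exact: ltW|rewrite gerBl].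
have CE0 : 0 <= C * expR (s * t) by rewrite mulr_ge0 ?expR_ge0.
move: e1 e2 e3; rewrite -!mulrA.
set E := C * expR (s * t) => e1 e2 e3.
rewrite /volterra_step normrM normrN normfV mulrC ler_pdivrMr//.
apply: le_trans (ler_normB _ _) _; apply: le_trans (lerD (ler_normB _ _) (lexx _)) _.
rewrite !normrM.
have q0 : 0 <= s `^ (- alpha) by exact: powR_ge0.
have h1 : `|rl_int alpha y t| <= K^-1 * E by apply: le_trans e1 _; rewrite ler_wpM2r.
have sK2 := le_trans s2 sK.
have h2 : `|rl_int (2 * alpha) y t| <= K^-1 * E by apply: le_trans e2 _; rewrite ler_wpM2r.
have h3 : `|rl_int (2 * alpha) y (t - tau)| <= K^-1 * E by apply: le_trans e3 _; rewrite ler_wpM2r.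
have h2' := ler_wpM2l na0 h2; have h3' := ler_wpM2l nb0 h3.
apply: le_trans (lerD (lerD h1 h2') h3') _.
rewrite (_ : C * (2^-1 * expR (s * t)) * `|c| = (1 + `|a| + `|b|) * (K^-1 * E)).
  by rewrite le_eqVlt; apply/orP; left; apply/eqP; ring.
by rewrite /K /E; field; rewrite !gt_eqF//; lra.
Qed.

(** Picard iteration in the weighted norm. The rate s is fixed before f, so one space serves all
    right-hand sides in it. *)
Lemma volterra_solvable : exists2 s, 0 < s & forall f, exp_cont s f -> causal f ->
  exists y, [/\ exp_cont s y, causal y & volterra_op y = f].
Proof.
have [s s0 Lh] := volterra_step_contraction; exists s => // f ef cf.
pose P := fix P n := if n is n'.+1 then (fun t => c^-1 * f t + volterra_step (P n') t) else fun=> 0.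
have eP n : exp_cont s (P n).
  elim: n => [|n IH]; first exact: exp_cont_cst0.
  by apply: exp_cont_lin => //; exact: exp_cont_volterra_step.
have iP n : rl_integrable (P n) := exp_cont_rl_integrable s0 (eP n).
have cP n : causal (P n).
  elim: n => [//|n IH] t t0 /=; rewrite cf// mulr0 add0r; exact: volterra_step_causal.
have eN y z : (fun t : R => y t - z t) = (fun t => - 1 * z t + y t) :> (R -> R).
  by apply/funext => t; ring.
have LB y z : rl_integrable y -> rl_integrable z ->
    volterra_step (fun t => y t - z t) = (fun t => volterra_step y t - volterra_step z t).
  by move=> iy iz; rewrite eN volterra_step_lin// -eN.
have eB y z : exp_cont s y -> exp_cont s z -> exp_cont s (fun t => y t - z t).
  by move=> ey ez; rewrite eN; exact: exp_cont_lin.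
have [D dP] : exists D, forall n, exp_le s (D * 2^-1 ^+ n) (fun t => P n.+1 t - P n t).
  have [_ [D hD]] := eB _ _ (eP 1%N) (eP 0%N).
  exists D; elim=> [|n IH]; first by rewrite expr0 mulr1.
  rewrite exprS mulrCA mulrC.
  have := Lh _ _ (continuous_measurable_fun (eB _ _ (eP n.+1) (eP n)).1) IH.
  rewrite LB// => h t; apply: le_trans (h t); rewrite le_eqVlt; apply/orP; left.
  apply/eqP; congr (`| _ |) => /=.
    by move: (volterra_step _ _) (volterra_step _ _) => p q; ring.
have /choice[y hy] : forall t : R, exists l : R, forall n,
    `|l - P n t| <= 2 * (D * expR (s * t)) * 2^-1 ^+ n.
  move=> t; apply: geometric_seq_limit => n; apply: le_trans (dP n t) _.
  by rewrite le_eqVlt; apply/orP; left; apply/eqP; ring.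
have hy' n t : `|y t - P n t| <= 2 * D * 2^-1 ^+ n * expR (s * t).
  by apply: le_trans (hy t n) _; rewrite le_eqVlt; apply/orP; left; apply/eqP; ring.
have ey : exp_cont s y.
  split; first by apply: (exp_cont_uniform_limit s0 _ hy') => n; have [] := eP n.
  by exists (2 * D) => t; have := hy' 0%N t; rewrite subr0 expr0 mulr1.
exists y; split => //.
- move=> t t0; apply/eqP; rewrite -normr_le0; apply/ler_addgt0Pl => e e0.
  have [n hn] := half_exp_small (2 * (D * expR (s * t))) e0.
  by rewrite addr0; have := hy t n; rewrite cP// subr0 => /le_trans; apply; exact: ltW.
- apply/funext => t; rewrite volterra_opE; apply/eqP.
  rewrite -(inj_eq (mulfI (invr_neq0 c0))) mulKf// -subr_eq0 -normr_le0.
  apply/ler_addgt0Pl => e e0; rewrite addr0.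
  have [n hn] := half_exp_small (3 * D * expR (s * t)) e0.
  apply: le_trans (ltW hn).
  have iy := exp_cont_rl_integrable s0 ey.
  have /(_ t) := Lh _ _ (continuous_measurable_fun (eB _ _ ey (eP n)).1) (hy' n).
  (* The residual of y is rewritten through P (n + 1) = f / c + [volterra_step] (P n); both
     resulting terms are of order 2^(-n). *)
  have -> : y t - volterra_step y t - c^-1 * f t =
      (y t - P n.+1 t) - volterra_step (fun t => y t - P n t) t.
    rewrite LB//=; move: (volterra_step _ _) (volterra_step _ _) => p q; ring.
  have := hy' n.+1 t; rewrite exprS.
  have := ler_normB (y t - P n.+1 t) (volterra_step (fun t => y t - P n t) t).
  set E := expR _; set p := 2^-1 ^+ n.
  rewrite (_ : 2 * D * (2^-1 * p) * E = D * p * E); last by field.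
  rewrite (_ : 2 * D * p / 2 * E = D * p * E); last by field.
  have := normr_ge0 (y t - P n.+1 t); lra.
Qed.

End Solve.
End Volterra.

(** * The equation without delay for right-hand sides singular at 0 *)

Section VolterraKernel.
Variable R : realType.

Lemma volterra_op_lin (alpha a b c tau k : R) (y z : R -> R) : 0 < alpha ->
  rl_integrable y -> rl_integrable z ->
  volterra_op alpha a b c tau (fun t => k * y t + z t) =
  (fun t => k * volterra_op alpha a b c tau y t + volterra_op alpha a b c tau z t).
Proof.
move=> a0 iy iz; have a20 : 0 < 2 * alpha by rewrite mulr_gt0.
apply/funext => t; rewrite /volterra_op (rl_int_lin k a0 iy iz) (rl_int_lin k a20 iy iz).
by ring.
Qed.

(** Brings a multiple into the shape k y + z of the linearity lemmas without involving a zero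
    function. *)
Lemma scaleE_lin (k : R) (y : R -> R) :
  (fun t => k * y t) = (fun t => (k - 1) * y t + y t).
Proof. by apply/funext => t; ring. Qed.

Lemma nice_scale s (k : R) (y : R -> R) : nice s y -> nice s (fun t => k * y t).
Proof. by move=> ny; rewrite scaleE_lin; exact: nice_lin. Qed.

Lemma volterra_op_scale (alpha a b c tau k : R) (y : R -> R) : 0 < alpha ->
  rl_integrable y -> volterra_op alpha a b c tau (fun t => k * y t) =
  (fun t => k * volterra_op alpha a b c tau y t).
Proof. by move=> a0 iy; rewrite scaleE_lin volterra_op_lin// -scaleE_lin. Qed.

(* The leading singularity of the solution is peeled off until the right-hand
   side is continuous. *)
Lemma volterra_kernel_solvable (alpha A c : R) : 0 < alpha -> c != 0 ->
  exists2 s, 0 < s & forall nu, 0 < nu ->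
  exists2 y, nice s y & volterra_op alpha A 0 c 0 y = rl_kernel nu.
Proof.
move=> alpha0 c0; have [s s0 solve] := volterra_solvable A 0 alpha0 c0 (lexx 0).
exists s => // nu nu0.
have a20 : 0 < 2 * alpha by rewrite mulr_gt0.
(* Each peeling raises the order by at least alpha; n bounds the number of steps until the order
   exceeds 1 and the kernel is continuous. *)
have [n] : exists n : nat, 1 < nu + n%:R * alpha.
  exists (Num.truncn (1 / alpha)).+1.
  have := truncnS_gt (1 / alpha); rewrite ltr_pdivrMr// => h.
  by rewrite (lt_le_trans h)// lerDr ltW.
elim: n nu nu0 => [|n IH] nu nu0 hn.
  have nu1 : 1 < nu by move: hn; rewrite mul0r addr0.
  have [y [ey cy Vy]] := solve _ (exp_cont_rl_kernel s0 nu1) (fun t => @rl_kernel_le0 R nu t).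
  by exists y => //; exact: nice_exp.
have [y1 n1 V1] : exists2 y, nice s y & volterra_op alpha A 0 c 0 y = rl_kernel (nu + alpha).
  apply: IH; first by rewrite addr_gt0.
  by move: hn; rewrite -natr1 mulrDl mul1r addrA addrAC.
have [y2 n2 V2] : exists2 y, nice s y & volterra_op alpha A 0 c 0 y = rl_kernel (nu + 2 * alpha).
  apply: IH; first by rewrite addr_gt0.
  apply: lt_trans hn _; rewrite -natr1 mulrDl mul1r; lra.
have i1 := nice_rl_integrable s0 n1; have i2 := nice_rl_integrable s0 n2.
have nk : nice s (rl_kernel nu) by exact: nice_kernel.
have ik := nice_rl_integrable s0 nk.
have nz := nice_scale c^-1 nk; have iz := nice_rl_integrable s0 nz.
have nw := nice_lin (A / c) n2 nz; have iw := nice_rl_integrable s0 nw.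
(* V (k_nu / c) = k_nu + k_(nu + alpha) / c - (A / c) k_(nu + 2 alpha); [y1] and [y2] remove the two
   surplus kernels. *)
exists (fun t => - c^-1 * y1 t + ((A / c) * y2 t + c^-1 * rl_kernel nu t)).
  exact: nice_lin.
rewrite (volterra_op_lin A 0 c 0 (- c^-1) alpha0 i1 iw).
rewrite (volterra_op_lin A 0 c 0 (A / c) alpha0 i2 iz).
rewrite (volterra_op_scale A 0 c 0 c^-1 alpha0 ik) V1 V2.
apply/funext => t; rewrite /volterra_op !rl_int_kernel// mul0r subr0.
rewrite (addrC alpha) (addrC (2 * alpha)).
move: (rl_kernel _ _) (rl_kernel _ _) (rl_kernel _ _) => p q r.
by field.
Qed.

End VolterraKernel.

(** * Caputo derivatives *)

Section Caputo.
Variable R : realType.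
Local Notation mu := (@lebesgue_measure R).

Lemma caputo_order1 (m : R) : 0 < m <= 1 -> caputo_order m = 1%N.
Proof.
move=> m01; rewrite /caputo_order (_ : Num.ceil m = 1)//.
by apply: ceil_def; rewrite subrr.
Qed.

Lemma caputo_order2 (m : R) : 1 < m <= 2 -> caputo_order m = 2%N.
Proof.
move=> m12; rewrite /caputo_order (_ : Num.ceil m = 2)//.
by apply: ceil_def.
Qed.

(** Connects the integral over [0, t] in [caputo] with the convolution [rl_int]. Only values inside
    ]0, t[ matter: the endpoints are null, and outside either g or the kernel vanishes. *)
Lemma rl_integral_itv (s m t : R) (g h : R -> R) : 0 < s -> 0 < m -> 0 < t -> nice s g ->
  (forall r, 0 < r -> h r = g r) ->
  mu.-integrable `[0, t] (fun r => ((t - r) `^ (m - 1) * h r)%:E) /\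
  (Gamma m)^-1 * \int[mu]_(r in `[0, t]) ((t - r) `^ (m - 1) * h r) = rl_int m g t.
Proof.
move=> s0 m0 t0 ng hg.
pose F r := (t - r) `^ (m - 1) * h r.
have G0 := Gamma_gt0 m0.
have ig := nice_rl_integrable s0 ng t m0.
have igr := int_on_R_reflect t ig.
have E r : (F \_ `]0, t[) r = Gamma m * (rl_kernel m (t - r) * g (t - (t - r))).
  rewrite patchE mem_setE in_itv/= subKr.
  case: ifPn => [/andP[r0 rt]|].
    by rewrite /F rl_kernelE ?subr_gt0// hg//; field; rewrite gt_eqF.
  rewrite negb_and -!leNgt => /orP[r0|tr].
    by rewrite (nice_causal ng)// !mulr0.
  by rewrite rl_kernel_le0 ?subr_le0// mul0r mulr0.
have iF : mu.-integrable `]0, t[ (EFin \o F).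
  apply/integrable_mkcond => //; rewrite restrict_EFin.
  have := int_on_RZ (Gamma m) igr; apply: eq_int_on_R => r; exact/esym/E.
have mF : measurable_fun `]0, t[ F by apply/measurable_EFinP; exact: measurable_int iF.
have mFc : measurable_fun `[0, t] F by exact: measurable_fun_itv_cc mF.
have cc (f : R -> \bar R) : measurable_fun `]0, t[ f ->
    (\int[mu]_(r in `[0%R, t]) f r = \int[mu]_(r in `]0%R, t[) f r)%E.
  by move=> mf; exact: integral_itv_bndoo.
have iFc : mu.-integrable `[0, t] (EFin \o F).
  apply/integrableP; split; first exact/measurable_EFinP.
  rewrite cc; first by case/integrableP : iF.
  by apply: measurableT_comp => //; exact/measurable_EFinP.
split; first exact: iFc.
rewrite {1}/Rintegral cc -/(Rintegral mu _ F); last exact/measurable_EFinP.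
rewrite Rintegral_mkcond; under eq_Rintegral do rewrite E.
rewrite RintegralZl; [|by []|exact: igr].
by rewrite (Rintegral_reflect t ig) mulKf ?gt_eqF// rl_intE.
Qed.

(** Increments of f are integrals of g over disjoint intervals, so the claim is absolute continuity
    of the integral, applied to g cut off at T to be integrable on the line. *)
Lemma absolutely_continuous_rl_int1 (s T p : R) (g f : R -> R) : 0 < s -> nice s g ->
  (forall t, 0 < t -> f t = p + rl_int 1 g t) ->
  absolutely_continuous_on `]0, T] f.
Proof.
move=> s0 ng fg e e0.
have ig := nice_rl_integrable s0 ng.
have iG : mu.-integrable `]-oo, T] (EFin \o g) by exact: integrable_rl1.
pose G := g \_ `]-oo, T].
have iGT : int_on_R G.
  have /integrable_mkcond := iG; rewrite restrict_EFin; apply.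
  exact: measurable_itv.
have inG : int_on_R (fun r => `|G r|) by exact: int_on_R_norm.
have [d [d0 hd]] := integral_normr_continuous iGT e0.
exists d => // n u v huv hdisj hsum.
(* Half-open, so that intervals with a common endpoint stay disjoint. *)
pose F i := `]u i, v i]%classic : set R.
pose A := \big[setU/set0]_(i < n) F i.
have mF i : measurable (F i) by exact: measurable_itv.
have mA : measurable A by apply: bigsetU_measurable.
have iF i : mu.-integrable (F i) (EFin \o (fun r => `|G r|)).
  exact: int_on_RS inG.
have tF : trivIset [set` index_iota 0 n] F.
  apply/trivIsetP => i j; rewrite /= !mem_index_iota /= => ni nj ij.
  apply/seteqP; split => // r [].
  rewrite /F /= !in_itv/= => /andP[ui vi] /andP[uj vj].
  move: ij; rewrite neq_ltn => /orP[ij|ji].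
    by have := hdisj i j; rewrite ij nj => /(_ isT); lra.
  by have := hdisj j i; rewrite ji ni => /(_ isT); lra.
have EA : \int[mu]_(r in A) `|G r| = \sum_(i < n) \int[mu]_(r in F i) `|G r|.
  apply: EFin_inj; rewrite -sumEFin /Rintegral fineK; last first.
    by apply: integrable_fin_num => //; exact: int_on_RS inG.
  rewrite /A -(big_mkord xpredT) ge0_integral_bigsetU//.
  - rewrite big_mkord; apply: eq_bigr => i _; rewrite fineK//.
    by apply: integrable_fin_num; [exact: mF|exact: iF].
  - exact: iota_uniq.
  - apply: measurable_funTS; apply/measurable_EFinP; exact: int_on_R_measurable.
have leF (i : 'I_n) : `|f (v i) - f (u i)| <= \int[mu]_(r in F i) `|G r|.
  have [ui vi uvi] := huv i (ltn_ord i).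
  move: ui vi; rewrite /= !in_itv/= => /andP[ui0 uiT] /andP[vi0 viT].
  rewrite !fg// opprD addrACA subrr add0r !rl_int1E//.
  rewrite (@Rintegral_itvB _ g -oo%O (BRight (v i)) (u i)); last 3 first.
  - exact: integrable_rl1.
  - by [].
  - by rewrite bnd_simp.
  rewrite -/(F i); have -> : \int[mu]_(r in F i) g r = \int[mu]_(r in F i) G r.
    apply: eq_Rintegral => r; rewrite inE /F /= in_itv/= => /andP[_ rv].
    by rewrite /G patchE mem_setE in_itv/= (le_trans rv viT).
  by apply: le_normr_Rintegral; [exact: mF|exact: int_on_RS iGT].
have EF (i : 'I_n) : mu (F i) = (v i - u i)%:E.
  have [_ _ uvi] := huv i (ltn_ord i).
  rewrite /F lebesgue_measure_itv/= lte_fin -EFinB; case: ltP => // vu.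
  by congr EFin; apply/esym/eqP; rewrite subr_eq0 eq_le vu uvi.
apply: (@le_lt_trans _ _ (\int[mu]_(r in A) `|G r|)).
  by rewrite EA; apply: ler_sum => i _; exact: leF.
apply: hd => //; apply: le_lt_trans (Boole_inequality _ _) _ => //.
  by move=> i _; exact: mF.
apply: (@le_lt_trans _ _ (\sum_(i < n) (v i - u i)%:E)%E).
  by apply: lee_sum => i _; rewrite le_eqVlt; apply/orP; left; apply/eqP; exact: EF.
by rewrite sumEFin lte_fin.
Qed.

Lemma is_derive_primitive (s p t : R) (g f : R -> R) : 0 < s -> nice s g -> 0 < t ->
  (forall r, 0 < r -> f r = p + rl_int 1 g r) -> is_derive t 1 f (g t).
Proof.
move=> s0 ng t0 fg.
have d : is_derive t 1 (fun r => p + rl_int 1 g r) (g t).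
  have dg := rl_int_derive s0 ng t0.
  by have := is_deriveD (is_derive_cst p t 1) dg; rewrite add0r.
apply: near_eq_is_derive d.
by near=> r; rewrite fg//; near: r; exact: lt_nbhsr.
Unshelve. all: by end_near. Qed.

(** Differentiation removes the initial value p, leaving x' = g for t > 0; the Caputo integral is
    then J^(1 - m) g, or g itself at m = 1. *)
Lemma caputo_primitive (s m p : R) (g x : R -> R) : 0 < s -> nice s g -> 0 < m <= 1 ->
  (forall t, 0 < t -> x t = p + rl_int 1 g t) ->
  caputo_derivable m x /\
  forall t, 0 < t -> caputo m x t = if m == 1 then g t else rl_int (1 - m) g t.
Proof.
move=> s0 ng m01 xg; have o1 := caputo_order1 m01.
have dx (t : R) (t0 : 0 < t) : is_derive t 1 x (g t) := is_derive_primitive s0 ng t0 xg.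
have dxE t : 0 < t -> derive1n 1 x t = g t.
  by move=> t0; rewrite derive1n1 derive1E; have [_ ->] := dx t t0.
have I t : 0 < t -> m != 1 -> _ :=
  fun t0 m1 => @rl_integral_itv s (1 - m) t g (derive1n 1 x) s0 _ t0 ng dxE.
have m1lt : m != 1 -> 0 < 1 - m by move=> m1; rewrite subr_gt0 lt_neqAle m1; case/andP: m01.
split.
  rewrite /caputo_derivable o1; split => //=.
  - by move=> T T0; exact: absolutely_continuous_rl_int1 ng xg.
  - move=> t t0; case: ifPn => m1; first by have [] := dx t t0.
    by have [] := I (m1lt m1) t t0 m1.
move=> t t0; rewrite /caputo o1; case: ifPn => m1; first exact: dxE.
by have [_] := I (m1lt m1) t t0 m1.
Qed.

(** The same one derivative later: q is the initial slope, which x'' = g no longer sees. *)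
Lemma caputo_second_primitive (s m q : R) (g z x : R -> R) : 0 < s -> nice s g -> 1 < m < 2 ->
  (forall t : R, 0 < t -> is_derive t 1 x (z t)) ->
  (forall t, 0 < t -> z t = q + rl_int 1 g t) ->
  caputo_derivable m x /\
  forall t, 0 < t -> caputo m x t = rl_int (2 - m) g t.
Proof.
move=> s0 ng /andP[m1 m2] dx zg.
have o2 : caputo_order m = 2%N by apply: caputo_order2; rewrite m1 ltW.
have dxE t : 0 < t -> derive1n 1 x t = z t.
  by move=> t0; rewrite derive1n1 derive1E; have [_ ->] := dx t t0.
have d1 t : 0 < t -> derive1n 1 x t = q + rl_int 1 g t.
  by move=> t0; rewrite dxE// zg.
have d2E t : 0 < t -> derive1n 2 x t = g t.
  move=> t0; rewrite derive1nS derive1E.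
  by have [_ ->] := is_derive_primitive s0 ng t0 d1.
have mN2 : (m == 2%:R) = false by rewrite lt_eqF.
have m20 : 0 < 2 - m by rewrite subr_gt0.
have I t : 0 < t -> _ := fun t0 => @rl_integral_itv s (2 - m) t g (derive1n 2 x) s0 m20 t0 ng d2E.
split.
  rewrite /caputo_derivable o2 mN2; split => //=.
  - move=> [|k]// t _ t0; have [] := dx t t0; by [].
  - by move=> T T0; exact: absolutely_continuous_rl_int1 ng d1.
  - by move=> t t0; have [] := I t t0.
by move=> t t0; rewrite /caputo o2 mN2; have [_] := I t t0.
Qed.

End Caputo.

(** * Laplace transform *)

Section Laplace.
Variable R : realType.
Local Notation mu := (@lebesgue_measure R).

(** Over the whole line; on causal functions this is the usual one-sided transform. *)
Definition laplace (lam : R) (v : R -> R) : R := \int[mu]_t (expR (- lam * t) * v t).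

Lemma laplace_bound s lam C (v : R -> R) t : exp_le s C v -> causal v ->
  `|expR (- lam * t) * v t| <= C * (rl_kernel 1 t * expR (- (lam - s) * t)).
Proof.
move=> vC cv; have C0 := exp_le_ge0 vC.
rewrite rl_kernel1; have [t0|t0] := leP t 0.
  by rewrite cv// mulr0 normr0 mul0r mulr0.
rewrite mul1r normrM ger0_norm ?expR_ge0// opprB mulrBl expRD mulrC.
apply: le_trans (ler_wpM2r (expR_ge0 _) (vC t)) _.
by rewrite mulNr mulrA.
Qed.

Lemma int_on_R_laplace s lam (v : R -> R) : s < lam -> exp_cont s v -> causal v ->
  int_on_R (fun t => expR (- lam * t) * v t).
Proof.
move=> sl [cv [C vC]] ca.
apply: (@int_on_R_le _ _ (fun t => C * (rl_kernel 1 t * expR (- (lam - s) * t)))).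
- apply: measurable_funM; first exact: measurable_expRZ.
  exact: continuous_measurable_fun.
- by apply: int_on_RZ; apply: int_on_R_rl_kernel_expR => //; rewrite subr_gt0.
- by move=> t; exact: laplace_bound.
Qed.

Lemma laplace_lin s lam (k : R) (v w : R -> R) : s < lam ->
  exp_cont s v -> causal v -> exp_cont s w -> causal w ->
  laplace lam (fun t => k * v t + w t) = k * laplace lam v + laplace lam w.
Proof.
move=> sl ev cv ew cw.
have iv := int_on_R_laplace sl ev cv; have iw := int_on_R_laplace sl ew cw.
rewrite /laplace -RintegralZl// -RintegralD//; last exact: (int_on_RZ k iv).
by apply: eq_Rintegral => t _; ring.
Qed.

Lemma laplace_rl_kernel lam nu : 0 < lam -> 0 < nu ->
  laplace lam (rl_kernel nu) = lam `^ (- nu).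
Proof.
move=> l0 n0; rewrite -Rintegral_rl_kernel_expR//.
by apply: eq_Rintegral => t _; rewrite mulrC.
Qed.

Lemma laplace_shift s lam tau (v : R -> R) : s < lam -> exp_cont s v -> causal v ->
  laplace lam (fun t => v (t - tau)) = expR (- lam * tau) * laplace lam v.
Proof.
move=> sl ev cv; have iv := int_on_R_laplace sl ev cv.
rewrite /laplace -(Rintegral_shift tau iv) -RintegralZl//; last exact: (int_on_R_shift tau iv).
apply: eq_Rintegral => t _; rewrite mulrA -expRD; congr (expR _ * _); ring.
Qed.

(** The convolution theorem, by Fubini: the integral in t for fixed u is a shifted transform of v,
    and the one in u is the transform of k_m. *)
Lemma laplace_rl_int s lam m (v : R -> R) : 0 < m -> 0 < s -> s < lam ->
  exp_cont s v -> causal v ->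
  laplace lam (rl_int m v) = lam `^ (- m) * laplace lam v.
Proof.
move=> m0 s0 sl /[dup] ev [cv [C vC]] ca.
have mv := continuous_measurable_fun cv; have C0 := exp_le_ge0 vC.
have l0 : 0 < lam by exact: lt_trans sl.
have ls0 : 0 < lam - s by rewrite subr_gt0.
have iv := int_on_R_laplace sl ev ca.
pose h (t u : R) := expR (- lam * t) * (rl_kernel m u * v (t - u)).
have iu t : int_on_R (fun u => rl_kernel m u * v (t - u)).
  exact: int_on_R_rl_exp vC.
have ivu u : int_on_R (fun t => expR (- lam * u) * (expR (- lam * (t - u)) * v (t - u))).
  by apply: int_on_RZ; exact: (int_on_R_shift u iv).
have hE t u : h t u = rl_kernel m u * (expR (- lam * u) * (expR (- lam * (t - u)) * v (t - u))).
  rewrite /h mulrCA; congr (_ * _); rewrite mulrA -expRD; congr (expR _ * _); ring.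
transitivity (\int[mu]_t (\int[mu]_u h t u)).
  apply: eq_Rintegral => t _; rewrite rl_intE -RintegralZl//.
  exact: iu.
have mh : measurable_fun [set: R * R] (fun z => h z.1 z.2).
  apply: measurable_funM.
    exact: (measurableT_comp (measurable_expRZ (- lam)) measurable_fst).
  apply: measurable_funM.
    exact: (measurableT_comp (measurable_rl_kernel m) measurable_snd).
  by apply: (measurableT_comp mv); exact: measurable_funB.
rewrite Rintegral_fubini//.
- transitivity (\int[mu]_u (laplace lam v * (rl_kernel m u * expR (- lam * u)))).
    apply: eq_Rintegral => u _; under eq_Rintegral do rewrite hE.
    rewrite RintegralZl//; last exact: ivu.
    rewrite RintegralZl//; last exact: (int_on_R_shift u iv).
    by rewrite (Rintegral_shift u iv) -/(laplace lam v); ring.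
  rewrite RintegralZl//; last exact: int_on_R_rl_kernel_expR.
  by rewrite Rintegral_rl_kernel_expR// mulrC.
(* The rate lam is split as (lam - s) + s: the first part makes the majorant integrable in t > 0,
   the second one in u. *)
- have hle t u : `|h t u| <= C * (rl_kernel 1 t * expR (- (lam - s) * t)) *
      (rl_kernel m u * expR (- s * u)).
    rewrite rl_kernel1; have [t0|t0] := leP t 0.
      have [u0|u0] := leP u 0; first by rewrite /h rl_kernel_le0// !(mul0r, mulr0) normr0.
      by rewrite /h ca ?(mulr0, mul0r) ?normr0//; lra.
    rewrite mul1r /h normrM ger0_norm ?expR_ge0//.
    apply: le_trans (ler_wpM2l (expR_ge0 _) (rl_integrand_le t u m0 vC)) _.
    rewrite (_ : - (lam - s) * t = - lam * t + s * t); last by ring.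
    by rewrite expRD le_eqVlt; apply/orP; left; apply/eqP; ring.
  pose D (t : R) := C * (rl_kernel 1 t * expR (- (lam - s) * t)).
  have D0 t : 0 <= D t by rewrite mulr_ge0// mulr_ge0 ?rl_kernel_ge0 ?expR_ge0.
  have iD : int_on_R D by apply: int_on_RZ; exact: int_on_R_rl_kernel_expR.
  have iDs := int_on_RZ (s `^ (- m)) iD.
  move: (int_on_R_lty iDs); apply: le_lt_trans; apply: ge0_le_integral => //=.
  + by move=> t _; apply: integral_ge0 => u _; rewrite lee_fin.
  + apply: (@measurable_fun_fubini_tonelli_F _ _ _ _ R mu (fun z => `|h z.1 z.2|%:E)) => //.
    by apply/measurable_EFinP; apply: measurableT_comp.
  + by apply/measurable_EFinP; apply: measurableT_comp => //; exact: int_on_R_measurable iDs.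
  + move=> t _; have ik := int_on_R_rl_kernel_expR m0 s0.
    apply: (@le_trans _ _ (\int[mu]_u ((D t)%:E * (rl_kernel m u * expR (- s * u))%:E))%E).
      apply: ge0_le_integral => //=.
      * apply/measurable_EFinP; apply: measurableT_comp => //.
        exact: (measurableT_comp mh (pair1_measurable t)).
      * apply: emeasurable_funM => //; apply/measurable_EFinP; exact: int_on_R_measurable ik.
      * by move=> u _; rewrite -EFinM lee_fin; exact: hle.
    rewrite ge0_integralZl//=; first last.
    * by rewrite lee_fin.
    * by move=> u _; rewrite lee_fin mulr_ge0 ?rl_kernel_ge0 ?expR_ge0.
    * by apply/measurable_EFinP; exact: int_on_R_measurable ik.
    rewrite ge0_integral_rl_kernel_expR// -EFinM lee_fin mulrC.
    exact: ler_norm.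
- by move=> t; apply: int_on_RZ; exact: iu.
- move=> u; have := int_on_RZ (rl_kernel m u) (ivu u); apply: eq_int_on_R => t.
  by rewrite hE.
Qed.

Lemma causal_shift (tau : R) (v : R -> R) : 0 <= tau -> causal v -> causal (fun t => v (t - tau)).
Proof. by move=> t0 cv t t1; rewrite cv//; lra. Qed.

Lemma causal_lin (k : R) (v w : R -> R) : causal v -> causal w -> causal (fun t => k * v t + w t).
Proof. by move=> cv cw t t0; rewrite cv// cw// mulr0 addr0. Qed.

(* At a characteristic root the symbol of the Volterra operator vanishes. *)
Lemma laplace_volterra_root (alpha a b c tau s lam : R) (v : R -> R) :
  0 < alpha -> 0 <= tau -> 0 < s -> s < lam ->
  characteristic_root alpha a b c tau lam ->
  exp_cont s v -> causal v -> laplace lam (volterra_op alpha a b c tau v) = 0.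
Proof.
move=> alpha0 tau0 s0 sl root ev cv.
have a20 : 0 < 2 * alpha by rewrite mulr_gt0.
have l0 : 0 < lam by exact: lt_trans sl.
have e1 := exp_cont_rl_int alpha0 s0 ev; have c1 := rl_int_causal alpha cv.
have e2 := exp_cont_rl_int a20 s0 ev; have c2 := rl_int_causal (2 * alpha) cv.
have e3 := exp_cont_shift tau e2; have c3 := causal_shift tau0 c2.
have -> : volterra_op alpha a b c tau v = (fun t => c * v t + ((- a) * rl_int (2 * alpha) v t +
    ((- b) * rl_int (2 * alpha) v (t - tau) + rl_int alpha v t))).
  by apply/funext => t; rewrite /volterra_op; ring.
have e4 := exp_cont_lin (- b) e3 e1; have c4 := causal_lin (- b) c3 c1.
have e5 := exp_cont_lin (- a) e2 e4; have c5 := causal_lin (- a) c2 c4.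
rewrite (laplace_lin c sl ev cv e5 c5) (laplace_lin (- a) sl e2 c2 e4 c4).
rewrite (laplace_lin (- b) sl e3 c3 e1 c1) (laplace_shift tau sl e2 c2).
rewrite (laplace_rl_int alpha0 s0 sl ev cv) (laplace_rl_int a20 s0 sl ev cv).
move: (laplace lam v) => X.
move: root; rewrite /characteristic_root !powRN.
rewrite (_ : - lam * tau = - (lam * tau)); last by ring.
have p0 := powR_gt0 alpha l0; have q0 := powR_gt0 (2 * alpha) l0.
have q2 : lam `^ (2 * alpha) = lam `^ alpha ^+ 2.
  by rewrite (mulrC 2) powRrM powR_mulrn ?powR_ge0.
rewrite q2; move: (expR _) (lam `^ alpha) p0 => E p p0 root.
(* Eliminating c by the root equation leaves a rational identity in p = lam^alpha and E = e^(-lam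
   tau). *)
have -> : c = (a + b * E - p) / p ^+ 2.
  by rewrite -root; field; rewrite gt_eqF.
by field; rewrite gt_eqF.
Qed.

(** A bound at infinity replaces the a priori rate s by s1: up to T the old estimate is at most a
    constant, and e^(s1 t) >= 1 for t >= 0. *)
Lemma exp_cont_eventually (s s1 T M : R) (v : R -> R) : 0 < s -> 0 < s1 ->
  exp_cont s v -> causal v -> (forall t, T < t -> `|v t| <= M * expR (s1 * t)) ->
  exp_cont s1 v.
Proof.
move=> s0 s10 [cv [C vC]] ca hM; split => //.
have C0 := exp_le_ge0 vC.
exists (`|M| + C * expR (s * T)) => t.
have E0 : 0 <= expR (s1 * t) by exact: expR_ge0.
have M0 : 0 <= C * expR (s * T) by rewrite mulr_ge0 ?expR_ge0.
have [t0|t0] := leP t 0.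
  by rewrite ca// normr0 mulr_ge0// addr_ge0.
have [tT|tT] := leP t T; last first.
  apply: le_trans (hM t tT) _; apply: ler_wpM2r => //.
  by apply: le_trans (ler_norm M) _; rewrite lerDl.
apply: (@le_trans _ _ (C * expR (s * T))).
  apply: le_trans (vC t) _; apply: ler_wpM2l => //.
  by rewrite ler_expR ler_wpM2l// ltW.
have E1 : 1 <= expR (s1 * t).
  by apply: le_trans (expR_ge1Dx _); rewrite lerDl mulr_ge0// ltW.
have := normr_ge0 M; nra.
Qed.

Lemma rl_integrable_shift (tau : R) (y : R -> R) : rl_integrable y ->
  rl_integrable (fun t => y (t - tau)).
Proof.
move=> iy m t m0; apply: eq_int_on_R (iy m (t - tau) m0) => u.
by congr (_ * y _); ring.
Qed.

(** For n = 2 - 2 alpha or n = 1 - 2 alpha these are the terms of the Caputo equation for x built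
    from J^2 y or J y. *)
Lemma rl_int_volterra (alpha a b c tau s n : R) (y : R -> R) : 0 < alpha -> 0 < n ->
  0 < s -> nice s y -> rl_int n (volterra_op alpha a b c tau y) =
  (fun t => c * rl_int n y t + rl_int (n + alpha) y t - a * rl_int (n + 2 * alpha) y t
            - b * rl_int (n + 2 * alpha) y (t - tau)).
Proof.
move=> alpha0 n0 s0 ny; have a20 : 0 < 2 * alpha by rewrite mulr_gt0.
have iy := nice_rl_integrable s0 ny.
have i1 := nice_rl_integrable s0 (nice_rl_int alpha0 s0 ny).
have i2 := nice_rl_integrable s0 (nice_rl_int a20 s0 ny).
have i3 := rl_integrable_shift tau i2.
have -> : volterra_op alpha a b c tau y = (fun t => c * y t + ((- a) * rl_int (2 * alpha) y t +
    ((- b) * rl_int (2 * alpha) y (t - tau) + rl_int alpha y t))).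
  by apply/funext => t; rewrite /volterra_op; ring.
have i4 := rl_integrable_lin (- b) i3 i1; have i5 := rl_integrable_lin (- a) i2 i4.
rewrite (rl_int_lin c n0 iy i5) (rl_int_lin (- a) n0 i2 i4) (rl_int_lin (- b) n0 i3 i1).
rewrite (rl_int_shift n tau (rl_int (2 * alpha) y)).
rewrite (rl_int_semigroup n0 alpha0 s0 ny) (rl_int_semigroup n0 a20 s0 ny).
have E p q r w : c * p + (- a * q + (- b * r + w)) = c * p + w - a * q - b * r.
  by ring.
by apply/funext => t; exact: E.
Qed.

(** Moves the equation from y, which may be singular at 0, to the continuous function J^n y to be
    transformed. *)
Lemma volterra_rl_int (alpha a b c tau s n : R) (y : R -> R) : 0 < alpha -> 0 < n ->
  0 < s -> nice s y ->
  volterra_op alpha a b c tau (rl_int n y) = rl_int n (volterra_op alpha a b c tau y).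
Proof.
move=> alpha0 n0 s0 ny; have a20 : 0 < 2 * alpha by rewrite mulr_gt0.
rewrite (rl_int_volterra a b c tau alpha0 n0 s0 ny); apply/funext => t.
rewrite /volterra_op (rl_int_semigroup alpha0 n0 s0 ny) (rl_int_semigroup a20 n0 s0 ny).
by rewrite (addrC alpha) (addrC (2 * alpha)).
Qed.

End Laplace.

(** * Instability *)

Section Instability.
Variable R : realType.

Lemma characteristic_root_exists (alpha a b c tau : R) :
  0 < alpha -> c < 0 -> 0 < b -> a < -1 / (4 * c) - b -> 0 <= tau ->
  exists2 lam, 0 < lam & characteristic_root alpha a b c tau lam.
Proof.
move=> alpha0 c0 b0 hac tau0.
pose k := - c; have k0 : 0 < k by rewrite oppr_gt0.
have hk : a < 1 / (4 * k) - b.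
  by move: hac; rewrite /k mulrN invrN mulrN mulNr.
(* Here u stands for lam^alpha. u0 maximises u - k u^2; at u1 one has k u1 = 1 + |a| + k and u1 >=
   1, whence u1 - k u1^2 <= -|a| <= a. *)
pose u0 : R := 1 / (2 * k); pose u1 : R := (1 + `|a|) / k + 1.
have a0 := normr_ge0 a.
have u00 : 0 < u0 by rewrite divr_gt0// mulr_gt0.
have u01 : u0 <= u1.
  rewrite /u0 /u1 ler_pdivrMr ?mulr_gt0//.
  have -> : ((1 + `|a|) / k + 1) * (2 * k) = 2 * (1 + `|a|) + 2 * k.
    by field; rewrite gt_eqF.
  lra.
have u10 : 0 < u1 by exact: lt_le_trans u01.
pose g (x : R) := x `^ alpha + c * x `^ (2 * alpha) - b * expR (- (x * tau)).
have gE u : 0 < u -> g (u `^ alpha^-1) = u - k * u ^+ 2 - b * expR (- (u `^ alpha^-1 * tau)).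
  move=> up; rewrite /g -!powRrM mulVf ?gt_eqF// powRr1 ?ltW//.
  rewrite mulrCA mulVf ?gt_eqF// mulr1 powR_mulrn ?ltW// /k; ring.
(* The delay term is at most b for every tau >= 0, which makes the bound at u0 independent of
   tau. *)
have E1 (x : R) : 0 <= x -> expR (- (x * tau)) <= 1.
  by move=> x0; rewrite expR_le1 oppr_le0 mulr_ge0.
have g0 : a <= g (u0 `^ alpha^-1).
  rewrite gE//; have := E1 (u0 `^ alpha^-1) (powR_ge0 _ _).
  have := expR_ge0 (- (u0 `^ alpha^-1 * tau)).
  have -> : u0 - k * u0 ^+ 2 = 1 / (4 * k) by rewrite /u0; field; rewrite gt_eqF.
  by move: (expR _) => E; nra.
have g1 : g (u1 `^ alpha^-1) <= a.
  rewrite gE//.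
  have := mulr_ge0 (ltW b0) (expR_ge0 (- (u1 `^ alpha^-1 * tau))).
  have ku1 : k * u1 ^+ 2 = u1 * (1 + `|a| + k).
    by rewrite /u1; field; rewrite gt_eqF.
  have u1g : 1 <= u1 by rewrite /u1 lerDr divr_ge0 ?ltW//; lra.
  have := ler_norm (- a); rewrite normrN.
  by rewrite ku1; move: (b * _) => E; nra.
have l01 : u0 `^ alpha^-1 <= u1 `^ alpha^-1.
  by apply: ge0_ler_powR; rewrite ?nnegrE ?invr_ge0 ?(ltW u00) ?(ltW u10) ?(ltW alpha0).
have cg : {within `[u0 `^ alpha^-1, u1 `^ alpha^-1], continuous g}.
  apply: continuous_in_subspaceT => x; rewrite inE/= in_itv/= => /andP[ux _].
  have x0 : 0 < x by apply: lt_le_trans ux; exact: powR_gt0.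
  apply: cvgB.
    apply: cvgD; first exact: continuous_powR_pos.
    by apply: cvgM; [exact: cvg_cst|exact: continuous_powR_pos].
  apply: cvgM; first exact: cvg_cst.
  apply: (@cvg_comp _ _ _ (fun x => - (x * tau)) expR); last exact: continuous_expR.
  by apply: cvgN; apply: cvgM; [exact: cvg_id|exact: cvg_cst].
have [|lam] := IVT (v := a) l01 cg.
  apply/andP; split.
    by rewrite ge_min; apply/orP; right; exact: g1.
  by rewrite le_max; apply/orP; left; exact: g0.
rewrite in_itv/= => /andP[ul _] gl; exists lam.
  by apply: lt_le_trans ul; exact: powR_gt0.
by rewrite /characteristic_root -gl /g subrK.
Qed.

(** The explicit part p grows at rate at most lam/2, while v may a priori grow at a rate s > lam. If
    x were bounded, v would have rate lam/2, its transform at lam would converge, and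
    [laplace_volterra_root] would apply. *)
Lemma not_bounded_near_pinfty (alpha a b c tau s C lam : R) (v p x : R -> R) :
  0 < alpha -> 0 <= tau -> 0 < s -> 0 < lam ->
  characteristic_root alpha a b c tau lam ->
  exp_cont s v -> causal v ->
  (forall t, 0 < t -> `|p t| <= C * expR (lam / 2 * t)) ->
  (forall t, 0 < t -> x t = p t + v t) ->
  laplace lam (volterra_op alpha a b c tau v) != 0 -> ~ bounded_near x +oo.
Proof.
move=> alpha0 tau0 s0 l0 root ev cv pC xpv /eqP neq0 bdd; apply: neq0.
have [M M0 [T [_ hT]]] := pinfty_ex_gt0 bdd.
have l20 : 0 < lam / 2 by rewrite divr_gt0.
have ev' : exp_cont (lam / 2) v.
  apply: (@exp_cont_eventually _ s (lam / 2) (Num.max T 0) (M + C) v) => // t.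
  rewrite gt_max => /andP[tT t0].
  have -> : v t = x t - p t by rewrite xpv//; ring.
  apply: le_trans (ler_normB _ _) _; rewrite mulrDl lerD//; last exact: pC.
  have xM : `|x t| <= M by exact: hT.
  apply: le_trans xM _; rewrite ler_peMr ?(ltW M0)//.
  by apply: le_trans (expR_ge1Dx _); rewrite lerDl mulr_ge0// ltW.
apply: (@laplace_volterra_root R alpha a b c tau (lam / 2) lam v) => //; lra.
Qed.

(** J^2 y has zero value and zero slope at 0, so orders below and above 1 obey one formula,
    applicable to alpha and 2 alpha alike. *)
Lemma caputo_rl_int2 (s m : R) (y x : R -> R) : 0 < s -> nice s y -> 0 < m < 2 ->
  (forall t, 0 < t -> x t = rl_int 2 y t) ->
  caputo_derivable m x /\ forall t, 0 < t -> caputo m x t = rl_int (2 - m) y t.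
Proof.
move=> s0 ny /andP[m0 m2] xy.
have ny1 := nice_rl_int ltr01 s0 ny.
have xy1 t : 0 < t -> x t = 0 + rl_int 1 (rl_int 1 y) t.
  by move=> t0; rewrite xy// add0r (rl_int_semigroup _ _ s0 ny).
have [m1|m1] := leP m 1.
  have [|d e] := @caputo_primitive R s m 0 (rl_int 1 y) x s0 ny1 _ xy1.
    by rewrite m0.
  split => // t t0; rewrite e//; case: eqVneq => [->|nm1].
    by rewrite (_ : 2 - 1 = 1 :> R)//; lra.
  have m1' : 0 < 1 - m by rewrite subr_gt0 lt_neqAle nm1.
  rewrite (rl_int_semigroup m1' ltr01 s0 ny).
  by congr (rl_int _ _ _); ring.
have dx (t : R) : 0 < t -> is_derive t 1 x (rl_int 1 y t).
  by move=> t0; exact: is_derive_primitive s0 ny1 t0 xy1.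
apply: (@caputo_second_primitive R s m 0 y (rl_int 1 y) x s0 ny _ dx).
  by rewrite m1.
by move=> t _; rewrite add0r.
Qed.

(** J y is continuous with value 0 at 0, so J^2 y is differentiable at 0 itself, with derivative
    0. *)
Lemma cvg_slope_rl_int2 (s : R) (y : R -> R) : 0 < s -> nice s y ->
  h^-1 * rl_int 2 y h @[h --> 0^'+] --> (0 : R).
Proof.
move=> s0 ny; have ny1 := nice_rl_int ltr01 s0 ny.
have [c1 _] := exp_cont_rl_int_nice (lexx 1) s0 ny.
have [d e] := is_derive_rl_int1 (nice_rl_integrable s0 ny1) (c1 0).
have z1 : rl_int 1 y 0 = 0 by apply: (nice_causal ny1).
have z2 : rl_int 1 (rl_int 1 y) 0 = 0 by apply: (nice_causal (nice_rl_int ltr01 s0 ny1)).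
have dl : h^-1 *: (rl_int 1 (rl_int 1 y) (h *: 1 + 0) - rl_int 1 (rl_int 1 y) 0)
    @[h --> 0^'] --> (0 : R) by rewrite -[X in _ --> X]z1 -e; exact: d.
have -> : (fun h => h^-1 * rl_int 2 y h) = (fun h : R => h^-1 *:
    (rl_int 1 (rl_int 1 y) (h *: 1 + 0) - rl_int 1 (rl_int 1 y) 0)).
  apply/funext => h; rewrite z2 subr0 addr0 (rl_int_semigroup ltr01 ltr01 s0 ny).
  by rewrite /GRing.scale/= mulr1.
exact: cvg_dnbhs_at_right dl.
Qed.

(* For nu = 3 the third difference of t_+^2, a quadratic B-spline.  The factors
   [- 1] and [1] match the linearity lemmas. *)
Definition bspline (h nu t : R) : R :=
  - 1 * rl_kernel nu (t - 3 * h) + (3 * rl_kernel nu (t - 2 * h) +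
    (- 3 * rl_kernel nu (t - 1 * h) + rl_kernel nu t)).

Lemma exp_cont_bspline s h nu : 0 < s -> 1 < nu -> exp_cont s (bspline h nu).
Proof.
move=> s0 nu1; have e := exp_cont_rl_kernel s0 nu1.
apply: exp_cont_lin; first exact: (exp_cont_shift (3 * h) e).
apply: exp_cont_lin; first exact: (exp_cont_shift (2 * h) e).
by apply: exp_cont_lin; first exact: (exp_cont_shift (1 * h) e).
Qed.

Lemma causal_rl_kernel nu : causal (rl_kernel nu : R -> R).
Proof. by move=> t; exact: rl_kernel_le0. Qed.

Lemma causal_bspline h nu : 0 <= h -> causal (bspline h nu).
Proof.
move=> h0 t t0; rewrite /bspline !rl_kernel_le0//; [ring|lra|lra|lra].
Qed.

Lemma rl_int_bspline h m nu : 0 < m -> 0 < nu ->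
  rl_int m (bspline h nu) = bspline h (m + nu).
Proof.
move=> m0 nu0.
have nk : nice 1 (rl_kernel nu : R -> R) by exact: nice_kernel.
have ik := nice_rl_integrable ltr01 nk.
have i1 := rl_integrable_shift (1 * h) ik.
have i2 := rl_integrable_shift (2 * h) ik.
have i3 := rl_integrable_shift (3 * h) ik.
have i4 := rl_integrable_lin (- 3) i1 ik.
have i5 := rl_integrable_lin 3 i2 i4.
rewrite /bspline (rl_int_lin (- 1) m0 i3 i5) (rl_int_lin 3 m0 i2 i4) (rl_int_lin (- 3) m0 i1 ik).
by rewrite !rl_int_shift rl_int_kernel.
Qed.

(** Each shift by h multiplies the transform by e^(-lam h), so the third difference becomes a
    cube. *)
Lemma laplace_bspline lam h nu : 0 < lam -> 0 <= h -> 1 < nu ->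
  laplace lam (bspline h nu) = lam `^ (- nu) * (1 - expR (- lam * h)) ^+ 3.
Proof.
move=> l0 h0 nu1; have nu0 : 0 < nu by lra.
have l20 : 0 < lam / 2 by rewrite divr_gt0.
have sl : lam / 2 < lam by lra.
have e := exp_cont_rl_kernel l20 nu1; have cc := @causal_rl_kernel nu.
have h1 : 0 <= 1 * h by rewrite mul1r.
have h2 : 0 <= 2 * h by rewrite mulr_ge0.
have h3 : 0 <= 3 * h by rewrite mulr_ge0.
have e1 := exp_cont_shift (1 * h) e; have c1 := causal_shift h1 cc.
have e2 := exp_cont_shift (2 * h) e; have c2 := causal_shift h2 cc.
have e3 := exp_cont_shift (3 * h) e; have c3 := causal_shift h3 cc.
have e4 := exp_cont_lin (- 3) e1 e; have c4 := causal_lin (- 3) c1 cc.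
have e5 := exp_cont_lin 3 e2 e4; have c5 := causal_lin 3 c2 c4.
rewrite /bspline (laplace_lin (- 1) sl e3 c3 e5 c5) (laplace_lin 3 sl e2 c2 e4 c4).
rewrite (laplace_lin (- 3) sl e1 c1 e cc) !(laplace_shift _ sl e cc) laplace_rl_kernel//.
have E k : expR (- lam * (k%:R * h)) = expR (- lam * h) ^+ k.
  by rewrite -expRM_natl; congr expR; ring.
rewrite (E 1%N) (E 2%N) (E 3%N).
by move: (expR _) (lam `^ _) => p q; ring.
Qed.

(** Beyond the last knot all four kernels are on their quadratic branch, and third differences of
    quadratics vanish. *)
Lemma bspline3_eq0 h t : 0 <= h -> 3 * h <= t -> bspline h 3 t = 0.
Proof.
move=> h0 ht.
have k3 u : 0 <= u -> rl_kernel 3 u = u ^+ 2 / Gamma 3 :> R.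
  rewrite le_eqVlt => /predU1P[<-|u0]; first by rewrite rl_kernel_le0// expr0n mul0r.
  rewrite rl_kernelE// -powR_mulrn ?ltW//; congr (_ `^ _ / _); ring.
rewrite /bspline !k3; [|lra|lra|lra|lra].
by ring.
Qed.

End Instability.

(** * The three cases: positive delay, and no delay with 2 alpha at most 1 or above 1 *)

Section Cases.
Variable R : realType.

Lemma rl_int_scale (m k : R) (y : R -> R) : 0 < m -> rl_integrable y ->
  rl_int m (fun t => k * y t) = (fun t => k * rl_int m y t).
Proof. by move=> m0 iy; rewrite scaleE_lin rl_int_lin// -scaleE_lin. Qed.

Lemma laplace_scale (s lam k : R) (v : R -> R) : s < lam -> exp_cont s v -> causal v ->
  laplace lam (fun t => k * v t) = k * laplace lam v.
Proof. by move=> sl ev cv; rewrite scaleE_lin (laplace_lin _ sl ev cv ev cv); ring. Qed.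

Lemma unstable_delay (alpha a b c tau lam : R) : 0 < alpha < 1 -> c != 0 -> b != 0 ->
  0 < tau -> 0 < lam -> characteristic_root alpha a b c tau lam ->
  unstable alpha a b c tau.
Proof.
move=> /andP[alpha0 alpha1] c0 b0 tau0 lam0 root st.
(* Three steps of width h span the delay, so the shifted spline fits into the history interval. *)
pose h := tau / 3; have h0 : 0 < h by rewrite divr_gt0.
have h3 : 3 * h = tau by rewrite /h; field.
have a20 : 0 < 2 * alpha by rewrite mulr_gt0.
have n1 : 1 < 1 + 2 * alpha by rewrite ltrDl.
have n0 : 0 < 1 + 2 * alpha by exact: lt_trans n1.
have [s s0 solve] := volterra_solvable a b alpha0 c0 (ltW tau0).
(* J^(2 - 2 alpha) raises the order 1 + 2 alpha to 3, the order at which the spline has compact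
   support. *)
have [y [ey cy Vy]] := solve _ (exp_cont_bspline h s0 n1) (causal_bspline _ (ltW h0)).
have ny := nice_exp ey cy.
have nw := nice_rl_int (ltr0n R 2) s0 ny.
have ew : exp_cont s (rl_int 2 y) by apply: exp_cont_rl_int.
have e3 := exp_cont_bspline h s0 (ltr_nat R 1 3).
(* On [-tau, 0] the second summand is the history, for t > 0 it vanishes. *)
pose x t := rl_int 2 y t + b^-1 * bspline h 3 (t + tau).
have xw t : 0 < t -> x t = rl_int 2 y t.
  move=> t0; rewrite /x bspline3_eq0 ?mulr0 ?addr0//; first exact: ltW.
  by rewrite h3 lerDr ltW.
have x0 : x 0 = 0.
  rewrite /x (nice_causal nw)// bspline3_eq0 ?mulr0 ?addr0//; first exact: ltW.
  by rewrite h3 add0r.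
have [|dA EA] := @caputo_rl_int2 R s alpha y x s0 ny _ xw.
  by rewrite alpha0 (lt_trans alpha1)// ltr1n.
have [|d2A E2A] := @caputo_rl_int2 R s (2 * alpha) y x s0 ny _ xw.
  by rewrite a20/= gtr_pMr.
have m20 : 0 < 2 - 2 * alpha by lra.
have key t : c * rl_int (2 - 2 * alpha) y t + rl_int (2 - alpha) y t
    - a * rl_int 2 y t - b * rl_int 2 y (t - tau) = bspline h 3 t.
  have := rl_int_volterra a b c tau alpha0 m20 s0 ny.
  rewrite Vy rl_int_bspline// => /(congr1 (@^~ t)).
  rewrite (_ : 2 - 2 * alpha + alpha = 2 - alpha); last by ring.
  rewrite (_ : 2 - 2 * alpha + 2 * alpha = 2); last by ring.
  by rewrite (_ : 2 - 2 * alpha + (1 + 2 * alpha) = 3)//; ring.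
have cx : continuous x.
  move=> t; apply: cvgD; first exact: ew.1.
  apply: cvgM; first exact: cvg_cst.
  apply: (@cvg_comp _ _ _ (fun t => t + tau) (bspline h 3)); last exact: e3.1.
  by apply: cvgD; [exact: cvg_id|exact: cvg_cst].
have sol : is_solution alpha a b c tau x 0 x.
  split => //.
  - exact: continuous_subspaceT.
  - move=> _; have := cvg_slope_rl_int2 s0 ny; apply: cvg_trans; apply: near_eq_cvg.
    by near=> r; rewrite x0 subr0 xw.
  (* The history part of b x(t - tau) is [bspline h 3 t], exactly the right-hand side of [key]. *)
  - move=> t t0; rewrite EA// E2A// xw// /x subrK -key mulrDr mulVKf//.
    by ring.
have l0h : 0 < lam * h by rewrite mulr_gt0.
apply: (not_bounded_near_pinfty (C := 0) (p := fun=> 0) alpha0 (ltW tau0) s0 lam0 root ew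
  (nice_causal nw) _ _ _ (st _ _ _ sol)).
- by move=> t _; rewrite normr0 mul0r.
- by move=> t t0; rewrite add0r xw.
- rewrite (volterra_rl_int a b c tau alpha0 (ltr0n R 2) s0 ny) Vy rl_int_bspline//.
  rewrite laplace_bspline//; [|exact: ltW|lra].
  rewrite mulf_neq0 ?expf_neq0 ?gt_eqF ?powR_gt0// subr_gt0 mulNr expR_lt1.
  by rewrite oppr_lt0.
Unshelve. all: by end_near. Qed.

Lemma characteristic_root_nodelay (alpha a b c lam : R) :
  characteristic_root alpha a b c 0 lam -> characteristic_root alpha (a + b) 0 c 0 lam.
Proof. by rewrite /characteristic_root mulr0 oppr0 expR0 mulr1 mul0r addr0. Qed.

Lemma unstable_nodelay_low (alpha a b c lam : R) : 0 < alpha -> 2 * alpha <= 1 ->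
  c != 0 -> a + b != 0 ->
  0 < lam -> characteristic_root alpha a b c 0 lam -> unstable alpha a b c 0.
Proof.
move=> alpha0 alpha1 c0 ab0 lam0 /characteristic_root_nodelay root st.
pose A := a + b.
have a20 : 0 < 2 * alpha by rewrite mulr_gt0.
have alt1 : alpha < 1 by lra.
have [s s0 solve] := volterra_kernel_solvable A alpha0 c0.
have [y0 ny0 Vy0] := solve _ a20.
pose y t := A * y0 t.
have ny : nice s y by exact: nice_scale.
have iy0 := nice_rl_integrable s0 ny0.
have Vy : volterra_op alpha A 0 c 0 y = (fun t => A * rl_kernel (2 * alpha) t).
  by rewrite /y (volterra_op_scale A 0 c 0 A alpha0 iy0) Vy0.
(* As 2 alpha <= 1, neither order exceeds 1 and one primitive serves both. *)
pose x t := 1 + rl_int 1 y t.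
have [|dA EA] := @caputo_primitive R s alpha 1 y x s0 ny _ (fun _ _ => erefl).
  by rewrite alpha0 ltW.
have [|d2A E2A] := @caputo_primitive R s (2 * alpha) 1 y x s0 ny _ (fun _ _ => erefl).
  by rewrite a20.
have ew := exp_cont_rl_int_nice (lexx 1) s0 ny.
have cw := nice_causal (nice_rl_int ltr01 s0 ny).
have sol : is_solution alpha a b c 0 x 0 x.
  split => //.
  - apply: continuous_subspaceT => t; apply: cvgD; [exact: cvg_cst|exact: ew.1].
  - by move=> h; exfalso; lra.
  - move=> t t0; rewrite EA// E2A// subr0 -mulrDl -/A (lt_eqF alt1).
    have k1 : rl_kernel 1 t = 1 by rewrite rl_kernel1 t0.
    have E p q r : c * p + q - A * r = A -> q + c * p = A + A * r.
      by move=> /eqP; rewrite subr_eq => /eqP <-; rewrite addrC.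
    (* At 2 alpha = 1 the higher derivative is y, and V y = f is already the equation; otherwise
       J^(1 - 2 alpha) of V y = f is. Either way the source is A k_1 = A. *)
    case: eqVneq => [a1|na1].
      have := congr1 (@^~ t) Vy; rewrite /volterra_op a1 k1 mul0r subr0 mulr1.
      rewrite (_ : 1 - alpha = alpha); last by lra.
      by rewrite /x mulrDr mulr1 => /E; exact.
    have m0 : 0 < 1 - 2 * alpha by rewrite subr_gt0 lt_neqAle na1.
    have := rl_int_volterra A 0 c 0 alpha0 m0 s0 ny.
    rewrite Vy (rl_int_scale A m0 (nice_rl_integrable s0 (nice_kernel s a20))).
    rewrite rl_int_kernel// => /(congr1 (@^~ t)).
    rewrite (_ : 1 - 2 * alpha + alpha = 1 - alpha); last by ring.
    rewrite (_ : 1 - 2 * alpha + 2 * alpha = 1); last by ring.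
    by rewrite k1 mul0r subr0 mulr1 /x mulrDr mulr1 => /esym/E; exact.
apply: (not_bounded_near_pinfty (C := 1) (p := fun=> 1) alpha0 (lexx 0) s0 lam0 root ew
  cw _ _ _ (st _ _ _ sol)).
- move=> t t0; rewrite normr1 mul1r; apply: le_trans (expR_ge1Dx _).
  by rewrite lerDl mulr_ge0 ?divr_ge0// ltW.
- by [].
- have n1 : 1 < 1 + 2 * alpha by rewrite ltrDl.
  have l20 : 0 < lam / 2 by rewrite divr_gt0.
  rewrite (volterra_rl_int A 0 c 0 alpha0 ltr01 s0 ny) Vy.
  rewrite (rl_int_scale A ltr01 (nice_rl_integrable s0 (nice_kernel s a20))) rl_int_kernel//.
  rewrite (laplace_scale A _ (exp_cont_rl_kernel l20 n1) (@causal_rl_kernel R _)); last by lra.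
  rewrite laplace_rl_kernel//; last by lra.
  (* The transform is A lam^(-(1 + 2 alpha)); here a + b != 0 is decisive. *)
  by rewrite mulf_neq0// gt_eqF// powR_gt0.
Qed.

Lemma unstable_nodelay_high (alpha a b c lam : R) : 1 < 2 * alpha -> alpha < 1 -> c != 0 ->
  0 < lam -> characteristic_root alpha a b c 0 lam -> unstable alpha a b c 0.
Proof.
move=> a21 alpha1 c0 lam0 /characteristic_root_nodelay root st.
pose A := a + b.
have a20 : 0 < 2 * alpha by lra.
have alpha0 : 0 < alpha by lra.
have [s s0 solve] := volterra_kernel_solvable A alpha0 c0.
have [y1 ny1 Vy1] := solve _ alpha0.
have [y2 ny2 Vy2] := solve _ a20.
have ny2' := nice_scale A ny2.
(* D^alpha k_2 = k_(2 - alpha) and D^(2 alpha) k_2 = 0, while the right-hand side contributes A k_2.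
   After J^(2 - 2 alpha) the chosen f compensates these terms. *)
pose y t := - 1 * y1 t + A * y2 t.
have ny : nice s y by exact: nice_lin.
have Vy : volterra_op alpha A 0 c 0 y =
    (fun t => - 1 * rl_kernel alpha t + A * rl_kernel (2 * alpha) t).
  have [i1 i2] := (nice_rl_integrable s0 ny1, nice_rl_integrable s0 ny2').
  rewrite /y (volterra_op_lin A 0 c 0 (- 1) alpha0 i1 i2).
  by rewrite (volterra_op_scale A 0 c 0 A alpha0 (nice_rl_integrable s0 ny2)) Vy1 Vy2.
have ika := nice_rl_integrable s0 (nice_kernel s alpha0).
have ik2a := nice_rl_integrable s0 (nice_kernel s a20).
have ik2a' := nice_rl_integrable s0 (nice_scale A (nice_kernel s a20)).
have JVy m : 0 < m -> rl_int m (volterra_op alpha A 0 c 0 y) =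
    (fun t => - 1 * rl_kernel (m + alpha) t + A * rl_kernel (m + 2 * alpha) t).
  move=> m0; rewrite Vy (rl_int_lin (- 1) m0 ika ik2a') (rl_int_scale A m0 ik2a).
  by rewrite !rl_int_kernel.
have nJ := nice_rl_int ltr01 s0 ny.
pose g t := 1 * rl_int 1 y t + rl_kernel 1 t.
have nk1 := nice_kernel s ltr01.
have ng : nice s g by exact: nice_lin.
pose x := rl_int 1 g.
have Jg m : 0 < m -> rl_int m g = (fun t => 1 * rl_int (m + 1) y t + rl_kernel (m + 1) t).
  move=> m0; rewrite /g (rl_int_lin 1 m0 (nice_rl_integrable s0 nJ) (nice_rl_integrable s0 nk1)).
  by rewrite (rl_int_semigroup m0 ltr01 s0 ny) rl_int_kernel.
have xE t : x t = rl_int 2 y t + rl_kernel 2 t by rewrite /x Jg// mul1r.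
have xg t : 0 < t -> x t = 0 + rl_int 1 g t by rewrite add0r.
have [|dA EA] := @caputo_primitive R s alpha 0 g x s0 ng _ xg.
  by rewrite alpha0 ltW.
have dx (t : R) : 0 < t -> is_derive t 1 x (g t) by move=> t0; exact: rl_int_derive ng t0.
have gE t : 0 < t -> g t = 1 + rl_int 1 y t.
  by move=> t0; rewrite /g rl_kernel1 t0 mul1r addrC.
have [|d2A E2A] := @caputo_second_primitive R s (2 * alpha) 1 y g x s0 ny _ dx gE.
  by rewrite a21/= gtr_pMr.
have ex := exp_cont_rl_int_nice (lexx 1) s0 ng.
have x0 : x 0 = 0 by exact: (nice_causal (nice_rl_int ltr01 s0 ng)).
have m20 : 0 < 2 - 2 * alpha by lra.
(* The slope at 0 comes from k_2(t) = t / Gamma(2) alone. *)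
have sol : is_solution alpha a b c 0 x (Gamma 2)^-1 x.
  split => //.
  - apply: continuous_subspaceT; exact: ex.1.
  - move=> _.
    have sl : h^-1 * rl_int 2 y h + (Gamma 2)^-1 @[h --> 0^'+] --> (Gamma 2)^-1.
      rewrite -[X in _ --> X]add0r; apply: cvgD; last exact: cvg_cst.
      exact: cvg_slope_rl_int2 s0 ny.
    apply: cvg_trans sl; apply: near_eq_cvg; near=> r.
    have r0 : 0 < r by [].
    rewrite x0 subr0 xE rl_kernelE// (_ : 2 - 1 = 1); last by lra.
    by rewrite powRr1 ?ltW// mulrDr mulrA mulVf ?mul1r// gt_eqF.
  - move=> t t0; rewrite EA// E2A// subr0 -mulrDl -/A (lt_eqF alpha1).
    have m0 : 0 < 1 - alpha by lra.
    rewrite (Jg _ m0) xE mul1r.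
    have := rl_int_volterra A 0 c 0 alpha0 m20 s0 ny.
    rewrite (JVy _ m20) => /(congr1 (@^~ t)).
    rewrite (_ : 2 - 2 * alpha + alpha = 2 - alpha); last by ring.
    rewrite (_ : 2 - 2 * alpha + 2 * alpha = 2); last by ring.
    rewrite (_ : 1 - alpha + 1 = 2 - alpha); last by ring.
    have E p q r r' k k' : c * p + q - A * r - 0 * r' = - 1 * k' + A * k ->
        q + k' + c * p = A * (r + k).
      move=> /eqP; rewrite -subr_eq0 => /eqP e; apply/eqP; rewrite -subr_eq0.
      by apply/eqP; rewrite -[RHS]e; ring.
    by move=> /esym/E; exact.
have ew : exp_cont s (rl_int 2 y) by apply: exp_cont_rl_int_nice => //; rewrite ler1n.
have cw := nice_causal (nice_rl_int (ltr0n R 2) s0 ny).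
have l20 : 0 < lam / 2 by rewrite divr_gt0.
have n2 : 1 < (2 : R) by rewrite ltr1n.
have [_ [C hC]] := exp_cont_rl_kernel l20 n2.
apply: (not_bounded_near_pinfty (C := C) (p := rl_kernel 2) alpha0 (lexx 0) s0 lam0 root ew
  cw _ _ _ (st _ _ _ sol)).
- by move=> t _; exact: hC.
- by move=> t _; rewrite xE addrC.
- have na : 1 < 2 + alpha by lra.
  have n2a : 1 < 2 + 2 * alpha by lra.
  have sl : lam / 2 < lam by lra.
  have ea := exp_cont_rl_kernel l20 na; have e2a := exp_cont_rl_kernel l20 n2a.
  rewrite (volterra_rl_int A 0 c 0 alpha0 (ltr0n R 2) s0 ny) JVy//.
  have ca := @causal_rl_kernel R (2 + alpha).
  have c2a := @causal_rl_kernel R (2 + 2 * alpha).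
  rewrite (laplace_lin (- 1) sl ea ca (exp_cont_scale A e2a)); last first.
    by move=> t t0; rewrite c2a// mulr0.
  rewrite (laplace_scale A sl e2a c2a) !laplace_rl_kernel//; [|lra|lra].
  (* The root equation gives A - lam^alpha = c lam^(2 alpha), so the transform of J^2 f is c
     lam^(-2). *)
  move: root; rewrite /characteristic_root mul0r addr0 -/A => <-.
  have -> : - (2 + 2 * alpha) = - (2 + alpha) - alpha by ring.
  have p0 := powR_gt0 alpha lam0.
  rewrite powR_gt0D// [lam `^ (- alpha)]powRN (mulrC 2 alpha) powRrM powR_mulrn ?powR_ge0//.
  rewrite (_ : _ + _ = c * (lam `^ (- (2 + alpha)) * lam `^ alpha)).
    by rewrite mulf_neq0// mulf_neq0 ?gt_eqF ?powR_gt0.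
  by field; rewrite gt_eqF.
Unshelve. all: by end_near. Qed.

End Cases.

Local Close Scope classical_set_scope.

Theorem theoremV2 (R : realType) (alpha a b c : R) :
  0 < alpha < 1 -> c < 0 -> 0 < b -> a < -1 / (4 * c) - b ->
  forall tau : R, 0 <= tau ->
    (exists2 lambda : R, 0 < lambda &
       characteristic_root alpha a b c tau lambda) /\
    (nondegenerate alpha a b tau -> unstable alpha a b c tau).
Proof.
move=> alpha01 c0 b0 hac tau tau0; have /andP[alpha0 alpha1] := alpha01.
have [lam lam0 root] := characteristic_root_exists alpha0 c0 b0 hac tau0.
split; first by exists lam.
have c0' : c != 0 by rewrite lt_eqF.
have b0' : b != 0 by rewrite gt_eqF.
move=> nd; have [tau1|tau1] := ltP 0 tau; first exact: unstable_delay root.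
have tauE : tau = 0 by apply/eqP; rewrite eq_le tau1 tau0.
subst tau; have [a21|a21] := ltP 1 (2 * alpha).
  exact: unstable_nodelay_high root.
(* With tau = 0 and 2 alpha <= 1 only a + b <> 0 survives. *)
case: nd => [|/eqP ab0|]; first by rewrite ltxx.
  exact: unstable_nodelay_low root.
by rewrite ltNge a21.
Qed.
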